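(* Let $n\ge 17$ be an integer. Then for every $A\in K_n$, $$\phi(A)\le \phi(n^{-1}J_n)=2-\frac{n!}{n^n}.$$ Moreover, for $A\in K_n$, equality $\phi(A)=\phi(n^{-1}J_n)$ holds if and only if $A=n^{-1}J_n$.
   Context: For a positive integer $n$, $K_n$ denotes the set of all real $n\times n$ matrices with nonnegative entries whose entries have total sum $n$. For $A=(a_{ij})\in K_n$, let $r_i=\sum_{j=1}^n a_{ij}$ and $c_j=\sum_{i=1}^n a_{ij}$ be the row and column sums. The permanent is $\operatorname{per}(A)=\sum_{\sigma\in S_n}\prod_{i=1}^n a_{i,\sigma(i)}$, where $S_n$ is the symmetric group on $\{1,\dots,n\}$. The Dittert function is $$\phi(A)=\prod_{i=1}^n r_i+\prod_{j=1}^n c_j-\operatorname{per}(A).$$ $J_n$ is the $n\times n$ matrix with all entries equal to $1$. *)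

(* Defs.v *)
From HB Require Import structures.
From mathcomp Require Import all_boot all_order all_fingroup all_algebra.
From mathcomp Require Import reals.

Set Implicit Arguments.
Unset Strict Implicit.
Unset Printing Implicit Defensive.

Import Order.TTheory GRing.Theory Num.Theory.

Local Open Scope ring_scope.

Definition Kset (R : realType) (n : nat) (A : 'M[R]_n) : Prop :=
  (forall i j : 'I_n, 0 <= A i j) /\ \sum_(i < n) \sum_(j < n) A i j = n%:R.

Definition row_sum (R : realType) (n : nat) (A : 'M[R]_n) (i : 'I_n) : R :=
  \sum_(j < n) A i j.

Definition col_sum (R : realType) (n : nat) (A : 'M[R]_n) (j : 'I_n) : R :=
  \sum_(i < n) A i j.

Definition permanent (R : realType) (n : nat) (A : 'M[R]_n) : R :=
  \sum_(s : 'S_n) \prod_(i < n) A i (s i).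

Definition dittert (R : realType) (n : nat) (A : 'M[R]_n) : R :=
  \prod_(i < n) row_sum A i + \prod_(j < n) col_sum A j - permanent A.

Definition allones (R : realType) (n : nat) : 'M[R]_n := const_mx 1.

(* Main.v *)
Require Import Defs.
From HB Require Import structures.
From mathcomp Require Import all_boot all_order all_fingroup all_algebra.
From mathcomp Require Import boolp reals.
From mathcomp Require Import ring lra zify.
From mathcomp Require classical_sets topology normedtype derive.

Set Implicit Arguments.
Unset Strict Implicit.
Unset Printing Implicit Defensive.

Import Order.TTheory GRing.Theory Num.Theory.

Local Open Scope ring_scope.

(**
Let [A] maximize the Dittert function and put [eps = n! / n^n], [P = per A],
[R] and [C] the products of the row sums [r_i] and of the column sums [c_j].
Comparing with the uniform matrix gives [P <= eps + R + C - 2], so that [A] is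
doubly stochastic up to an exponentially small error. Set [f_i = 1 - 1 / r_i]
and [g_j = 1 - 1 / c_j]. The first-order conditions on the simplex, summed
along rows and columns, yield
[sum a_ij (f_i + g_j)^2 <= eps (sum r_i f_i^2 + sum c_j g_j^2)].
If [f] and [g] do not both vanish, then a gap in the values of [f_i] and
[- g_j] shows that, up to a total mass of at most [2 n^3 eps], the matrix [A]
is a direct sum of two nearly doubly stochastic blocks of orders [k] and
[n - k], [0 < k < n]. The van der Waerden bound in Gurvits' capacity form,
applied to both blocks, then gives
[P >= 0.72 (k! / k^k) ((n - k)! / (n - k)^(n - k)) >= 1.44 eps > eps],
a contradiction. Hence [A] is doubly stochastic and [P = eps].
As in Egorychev's argument, the first-order conditions and Alexandrov's
inequality then show that mixing two rows of [A] keeps it a maximizer.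
Averaging all the rows but one into a row [b] leads to [n! prod b = eps], so
that [b], and then the remaining row, is constant.
*)

(** * Recursive permanents of lists of rows *)

Section RecursivePermanent.
Variables (R : comNzRingType) (I : finType).
Implicit Types (a b c : I -> R) (s t : seq (I -> R)) (S T : {set I}).

(** The permanent of the rows [s] on the columns [S], with the Laplace expansion along the first row
    as definition; it is 0 when [#|S|] differs from the number of rows. Lists allow repeated rows,
    which the mixed permanents below require. *)
Fixpoint mper s S : R :=
  if s is a :: s' then \sum_(i in S) a i * mper s' (S :\ i) else (S == set0)%:R.

Lemma mper_nil S : mper [::] S = (S == set0)%:R.
Proof. by []. Qed.

Lemma mper_cons a s S : mper (a :: s) S = \sum_(i in S) a i * mper s (S :\ i).
Proof. by []. Qed.

(** Expanding two rows gives a sum over ordered pairs of distinct columns, which is symmetric under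
    exchange of the indices. *)
Lemma mper_swap a b s S : mper [:: a, b & s] S = mper [:: b, a & s] S.
Proof.
have E x y : mper [:: x, y & s] S =
  \sum_(i in S) \sum_(j in S | j != i) x i * y j * mper s (S :\ i :\ j).
  rewrite /=; apply: eq_bigr => i iS; rewrite mulr_sumr.
  apply: eq_big => [j|j _]; last by rewrite mulrA.
  by rewrite !inE andbC.
rewrite !E (exchange_big_dep (mem S)) /=; last by move=> i j _ /andP[].
apply: eq_bigr => i iS; apply: eq_big => [j|j /andP[jS ij]].
  by rewrite iS /= eq_sym.
by rewrite [a _ * _]mulrC !setDDl [[set j] :|: _]setUC.
Qed.

Lemma mper_mid a s t S : mper (s ++ a :: t) S = mper (a :: s ++ t) S.
Proof.
elim: s S => // b s IH S.
by rewrite cat_cons mper_swap /=; apply: eq_bigr => i _; rewrite IH.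
Qed.

Lemma mper_perm (J : eqType) (f : J -> I -> R) (u v : seq J) s S :
  perm_eq u v -> mper (map f u ++ s) S = mper (map f v ++ s) S.
Proof.
elim: u v S => [|x u IH] v S uv; first by have /perm_nilP -> : perm_eq v [::] by rewrite perm_sym.
have xv : x \in v by rewrite -(perm_mem uv) mem_head.
case/splitPr: xv uv => v1 v2 uv.
have uv' : perm_eq u (v1 ++ v2).
  by rewrite -(perm_cons x) (perm_trans uv) // -[x :: v2]cat1s perm_catCA.
rewrite map_cat /= -catA cat_cons mper_mid /= catA -map_cat.
by apply: eq_bigr => i _; rewrite (IH _ _ uv').
Qed.

Lemma mperD a b s S :
  mper ((fun i => a i + b i) :: s) S = mper (a :: s) S + mper (b :: s) S.
Proof. by rewrite /= -big_split; apply: eq_bigr => i _; rewrite mulrDl. Qed.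

Lemma mperZ x a s S : mper ((fun i => x * a i) :: s) S = x * mper (a :: s) S.
Proof. by rewrite /= mulr_sumr; apply: eq_bigr => i _; rewrite mulrA. Qed.

Lemma mper_nseq m a S : #|S| = m -> mper (nseq m a) S = m`!%:R * \prod_(i in S) a i.
Proof.
elim: m S => [|m IH] S cS /=.
  by rewrite (cards0_eq cS) eqxx big_set0 fact0 mulr1.
have E i : i \in S ->
  a i * mper (nseq m a) (S :\ i) = m`!%:R * \prod_(j in S) a j.
  move=> iS; rewrite IH; last by rewrite (cardsD1 i) iS in cS; case: cS.
  by rewrite [\prod_(_ in S) _](big_setD1 i) //= mulrCA.
by rewrite (eq_bigr _ E) sumr_const cS factS natrM -mulrA [RHS]mulr_natl.
Qed.

End RecursivePermanent.

Arguments mper {R I} s S : simpl never.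

(** * Permanents of nonnegative and positive rows *)

Section Positivity.
Variables (R : realDomainType) (I : finType).
Implicit Types (a b c : I -> R) (s t : seq (I -> R)) (S T : {set I}).

Definition nng s := forall a, List.In a s -> forall i, 0 <= a i.
Definition pos s := forall a, List.In a s -> forall i, 0 < a i.

Lemma nng_cons a s : (forall i, 0 <= a i) -> nng s -> nng (a :: s).
Proof. by move=> a0 s0 b [<-|/s0]. Qed.

Lemma pos_cons a s : (forall i, 0 < a i) -> pos s -> pos (a :: s).
Proof. by move=> a0 s0 b [<-|/s0]. Qed.

Lemma nng_tail a s : nng (a :: s) -> nng s.
Proof. by move=> h b bs; apply: h; right. Qed.

Lemma pos_tail a s : pos (a :: s) -> pos s.
Proof. by move=> h b bs; apply: h; right. Qed.

Lemma nng_map (J : Type) (f : J -> I -> R) u :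
  (forall j i, 0 <= f j i) -> nng (map f u).
Proof. by move=> f0; elim: u => //= j u IH; apply: nng_cons. Qed.

Lemma pos_cat s t : pos s -> pos t -> pos (s ++ t).
Proof.
elim: s => // a s IH h ht; apply: pos_cons; first by apply: h; left.
by apply: IH => //; apply: pos_tail h.
Qed.

Lemma pos_nseq m a : (forall i, 0 < a i) -> pos (nseq m a).
Proof. by move=> a0; elim: m => //= m IH; apply: pos_cons. Qed.

Lemma pos_nng s : pos s -> nng s.
Proof. by move=> h a /h a0 i; apply: ltW. Qed.

Lemma mper_ge0 s S : nng s -> 0 <= mper s S.
Proof.
elim: s S => [|a s IH] S h; first exact: ler0n.
rewrite mper_cons.
apply: sumr_ge0 => i _; apply: mulr_ge0; first by apply: h; left.
by apply: IH; apply: nng_tail h.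
Qed.

Lemma mper_gt0 s S : pos s -> #|S| = size s -> 0 < mper s S.
Proof.
elim: s S => [|a s IH] S h /= cS.
  by rewrite mper_nil (cards0_eq cS) eqxx ltr01.
have /card_gt0P[i iS] : (0 < #|S|)%N by rewrite cS.
rewrite mper_cons (big_setD1 i) //=; apply: ltr_pwDl.
  apply: mulr_gt0; first by apply: h; left.
  apply: IH; first exact: pos_tail h.
  by rewrite (cardsD1 i) iS in cS; case: cS.
apply: sumr_ge0 => j _; apply: mulr_ge0; first by apply/ltW; apply: h; left.
by apply/mper_ge0/pos_nng/(pos_tail h).
Qed.

(** The left side collects the terms in which the rows of [s] use columns of [S] and those of [t]
    columns of [T]; all other terms are nonnegative. *)
Lemma mper_cat_ge s t S T : nng s -> nng t -> [disjoint S & T] ->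
  mper s S * mper t T <= mper (s ++ t) (S :|: T).
Proof.
elim: s S => [|a s IH] S hs ht dST /=.
  rewrite mper_nil; case: eqP => [->|_]; first by rewrite mul1r set0U.
  by rewrite mul0r mper_ge0.
have hs' := nng_tail hs; have a0 : forall i, 0 <= a i by apply: hs; left.
rewrite !mper_cons mulr_suml.
rewrite [leRHS](eq_bigl [predU S & T]); last by move=> i; rewrite !inE.
rewrite bigU //=; apply: ler_wpDr.
  apply: sumr_ge0 => i _; apply: mulr_ge0 => //; apply: mper_ge0 => b.
  by move/List.in_app_iff => [/hs'|/ht].
apply: ler_sum => i iS; rewrite -mulrA ler_wpM2l //.
have -> : (S :|: T) :\ i = (S :\ i) :|: T.
  rewrite setDUl; congr (_ :|: _); apply/setDidPl.
  by rewrite disjoint_sym disjoints1 (disjointFr dST).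
by apply: IH => //; apply: disjointWl dST; apply: subsetDl.
Qed.

End Positivity.

(** * Alexandrov's inequality *)

(** Fredholm alternative: the kernel is the line of [h], so adding the rank-one matrix [h^T *m h]
    makes [M] invertible, and on right sides orthogonal to [h] the added part vanishes. *)
Lemma sym_mx_solve (R : realFieldType) (n : nat) (M : 'M[R]_n) (h y : 'rV[R]_n) :
    M^T = M -> h *m M = 0 -> h *m h^T != 0 ->
    (forall v : 'rV_n, v *m M = 0 -> exists c, v = c *: h) ->
    y *m h^T = 0 ->
  exists x : 'rV_n, x *m M = y.
Proof.
move=> Msym hM hh kerM yh.
have Mh : M *m h^T = 0.
  by rewrite -Msym -trmx_mul hM trmx0.
have scal (x : 'rV_n) : x *m (h^T *m h) = (x *m h^T) 0 0 *: h.
  by rewrite mulmxA {1}[x *m h^T]mx11_scalar mul_scalar_mx.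
have hh0 : (h *m h^T) 0 0 != 0.
  by apply: contraNneq hh => e; apply/eqP/matrixP => i j; rewrite !ord1 e mxE.
pose M' := M + h^T *m h.
have key (x z : 'rV_n) : x *m M' = z -> z *m h^T = 0 -> x *m M = z.
  move=> e zh; have : x *m M' *m h^T = 0 by rewrite e.
  rewrite mulmxDr scal mulmxDl -mulmxA Mh mulmx0 add0r -scalemxAl => /eqP.
  rewrite scaler_eq0 (negPf hh) orbF => /eqP e0.
  by move: e; rewrite mulmxDr scal e0 scale0r addr0.
have uM' : M' \in unitmx.
  rewrite -row_free_unit -kermx_eq0; apply/eqP/row_matrixP => i.
  set v := row i _; have vM' : v *m M' = 0.
    by apply/sub_kermxP; rewrite row_sub.
  have vM := key _ _ vM' (mul0mx _ _).
  have [c vc] := kerM _ vM; move: vM'; rewrite mulmxDr vM add0r scal vc.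
  move/eqP; rewrite scaler_eq0 -scalemxAl => /orP[|/eqP h0]; last first.
    by rewrite h0 scaler0 row0.
  rewrite mxE mulf_eq0 => /orP[/eqP->|]; first by rewrite scale0r row0.
  by rewrite (negPf hh0).
exists (y *m invmx M'); apply: key => //.
by rewrite -mulmxA mulVmx // mulmx1.
Qed.

(** * Symmetric bilinear forms on a finite set of columns *)

Section Forms.
Variables (R : realFieldType) (I : finType) (S : {set I}).
Implicit Types (v w h : I -> R) (Q : I -> I -> R).

Lemma sym_solve Q h y : (forall j k, Q j k = Q k j) ->
    {in S, forall j, 0 < h j} ->
    {in S, forall k, \sum_(j in S) h j * Q j k = 0} ->
    (forall v, {in S, forall k, \sum_(j in S) v j * Q j k = 0} ->
       exists c, {in S, forall j, v j = c * h j}) ->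
    \sum_(j in S) y j * h j = 0 ->
  exists x, {in S, forall k, \sum_(j in S) x j * Q j k = y k}.
Proof.
move=> Qsym h0 hQ kerQ yh.
have [->|[x0 x0S]] := set_0Vmem S; first by exists h => k; rewrite inE.
pose toR v : 'rV[R]_#|S| := \row_k v (enum_val k).
pose ofR (x : 'rV[R]_#|S|) (i : I) : R := x 0 (enum_rank_in x0S i).
pose M : 'M[R]_#|S| := \matrix_(j, k) Q (enum_val j) (enum_val k).
have toM v k : (toR v *m M) 0 k = \sum_(j in S) v j * Q j (enum_val k).
  by rewrite mxE [RHS]big_enum_val /=; apply: eq_bigr => j _; rewrite !mxE.
have ofK x : toR (ofR x) = x.
  by apply/rowP => k; rewrite mxE /ofR enum_valK_in.
have dotE v w : (toR v *m (toR w)^T) 0 0 = \sum_(j in S) v j * w j.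
  by rewrite mxE [RHS]big_enum_val /=; apply: eq_bigr => j _; rewrite !mxE.
have [|||v vM||x xM] := @sym_mx_solve R #|S| M (toR h) (toR y).
- by apply/matrixP => j k; rewrite !mxE.
- by apply/rowP => k; rewrite toM hQ ?mxE ?enum_valP.
- apply/negP => /eqP/matrixP/(_ 0 0)/eqP; rewrite dotE mxE gt_eqF //.
  rewrite (big_setD1 x0) //= ltr_pwDl ?mulr_gt0 ?h0 //.
  by apply: sumr_ge0 => j /setD1P[_ jS]; rewrite mulr_ge0 // ltW ?h0.
- have [|c vc] := kerQ (ofR v).
    move=> k kS; rewrite -(enum_rankK_in x0S kS) -toM ofK vM mxE //.
  by exists c; apply/rowP => k; rewrite -{1}[v]ofK !mxE vc ?enum_valP.
- by apply/matrixP => i j; rewrite !ord1 dotE mxE.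
exists (ofR x) => k kS.
by rewrite -{1}(enum_rankK_in x0S kS) -toM ofK xM mxE enum_rankK_in.
Qed.

Definition form Q v w := \sum_(j in S) v j * (\sum_(k in S) Q j k * w k).

Lemma formC Q v w : (forall j k, Q j k = Q k j) -> form Q v w = form Q w v.
Proof.
move=> Qsym; rewrite /form.
under eq_bigr do rewrite mulr_sumr; rewrite exchange_big /=.
apply: eq_bigr => k _; rewrite mulr_sumr; apply: eq_bigr => j _.
by rewrite (Qsym k j); ring.
Qed.

Lemma form_lin Q s t v w u :
  form Q (fun i => s * v i + t * w i) u = s * form Q v u + t * form Q w u.
Proof.
rewrite /form !mulr_sumr -big_split /=; apply: eq_bigr => j _.
by rewrite mulrDl !mulrA.
Qed.

Lemma form_quad Q s t v w : (forall j k, Q j k = Q k j) ->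
  form Q (fun i => s * v i + t * w i) (fun i => s * v i + t * w i) =
  s ^+ 2 * form Q v v + s * t * form Q v w *+ 2 + t ^+ 2 * form Q w w.
Proof.
move=> Qsym; rewrite form_lin (formC v) // (formC w) // !form_lin.
rewrite (formC w v) //; ring.
Qed.

Section Hyperbolic.
Variables (Q : I -> I -> R) (h : I -> R).
Hypothesis Qsym : forall j k, Q j k = Q k j.
Hypothesis Qgt0 : {in S &, forall j k, j != k -> 0 < Q j k}.
Hypothesis Qge0 : {in S &, forall j k, 0 <= Q j k}.
Hypothesis h_gt0 : {in S, forall j, 0 < h j}.
Let Qa v j := \sum_(k in S) Q j k * v k.
Hypothesis Qh_gt0 : {in S, forall j, 0 < Qa h j}.
Hypothesis local : forall v,
  form Q v v <= \sum_(j in S) h j * Qa v j ^+ 2 / Qa h j.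

(** The diagonal for which [L], that is [diag d - Q], annihilates [h]: [L] is a weighted graph
    Laplacian in the variables [v j / h j]. *)
Let d j := Qa h j / h j.
Let L j k : R := (j == k)%:R * d j - Q j k.

Let d_gt0 : {in S, forall j, 0 < d j}.
Proof. by move=> j jS; rewrite divr_gt0 ?Qh_gt0 ?h_gt0. Qed.

Let Lsym j k : L j k = L k j.
Proof.
by rewrite /L Qsym eq_sym; case: eqP => [->|_] //; rewrite !mul0r.
Qed.

Let La v j : j \in S -> \sum_(k in S) L j k * v k = d j * v j - Qa v j.
Proof.
move=> jS; rewrite /L; under eq_bigr do rewrite mulrBl.
rewrite sumrB; congr (_ - _); rewrite (bigD1 j) //= eqxx mul1r big1 ?addr0 //.
by move=> k /andP[_]; rewrite eq_sym => /negPf ->; rewrite !mul0r.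
Qed.

Let formL v : form L v v = \sum_(j in S) d j * v j ^+ 2 - form Q v v.
Proof.
rewrite /form -sumrB; apply: eq_bigr => j jS; rewrite La // mulrBr; congr (_ - _).
by rewrite mulrCA expr2.
Qed.

Let formL_sq v : form L v v =
  2^-1 * \sum_(j in S) \sum_(k in S) Q j k * h j * h k * (v j / h j - v k / h k) ^+ 2.
Proof.
pose X := \sum_(j in S) \sum_(k in S) Q j k * h k / h j * v j ^+ 2.
have XE : X = \sum_(j in S) d j * v j ^+ 2.
  apply: eq_bigr => j jS; rewrite /d /Qa !mulr_suml; apply: eq_bigr => k kS.
  by rewrite mulrA.
have XE' : X = \sum_(j in S) \sum_(k in S) Q j k * h j / h k * v k ^+ 2.
  rewrite /X exchange_big /=; apply: eq_bigr => k _; apply: eq_bigr => j _.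
  by rewrite Qsym.
have -> : \sum_(j in S) \sum_(k in S)
   Q j k * h j * h k * (v j / h j - v k / h k) ^+ 2 = X + X - 2 * form Q v v.
  rewrite {2}XE' /X mulr_sumr -big_split -sumrB; apply: eq_bigr => j jS /=.
  rewrite !mulr_sumr -big_split -sumrB; apply: eq_bigr => k kS /=.
  have hj := h_gt0 jS; have hk := h_gt0 kS.
  by field; rewrite !gt_eqF.
rewrite formL -XE; lra.
Qed.

Let formL_ge0 v : 0 <= form L v v.
Proof.
rewrite formL_sq mulr_ge0 ?invr_ge0 ?ler0n //.
apply: sumr_ge0 => j jS; apply: sumr_ge0 => k kS.
by rewrite mulr_ge0 ?sqr_ge0 // !mulr_ge0 ?Qge0 // ltW ?h_gt0.
Qed.

(** All off-diagonal weights in [formL_sq] are positive, so comparison with the single index [x0]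
    already forces [v j / h j] to be constant. *)
Let formL_eq0 v : form L v v = 0 -> exists c, {in S, forall j, v j = c * h j}.
Proof.
have [->|[x0 x0S]] := set_0Vmem S; first by exists 0 => k; rewrite inE.
rewrite formL_sq => /eqP; rewrite mulf_eq0 invr_eq0 pnatr_eq0 /= psumr_eq0; last first.
  move=> j jS; apply: sumr_ge0 => k kS.
  by rewrite mulr_ge0 ?sqr_ge0 // !mulr_ge0 ?Qge0 // ltW ?h_gt0.
move=> /allP/(_ x0); rewrite mem_index_enum x0S /= => /(_ isT); rewrite psumr_eq0; last first.
  move=> k kS.
  by rewrite mulr_ge0 ?sqr_ge0 // !mulr_ge0 ?Qge0 // ltW ?h_gt0.
move=> /allP e; exists (v x0 / h x0) => j jS.
have [->|jx0] := eqVneq j x0; first by rewrite divfK // gt_eqF ?h_gt0.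
have := e j; rewrite mem_index_enum jS /= => /(_ isT).
have Qj : 0 < Q x0 j * h x0 * h j by rewrite !mulr_gt0 ?Qgt0 ?h_gt0 // eq_sym.
rewrite mulf_eq0 (gt_eqF Qj) /= sqrf_eq0 subr_eq0 => /eqP ->.
by rewrite divfK // gt_eqF ?h_gt0.
Qed.

(* With [D = diag (d j)] and [L = D - Q], the hypothesis [local] reads
   [<v, L v> <= <L v, D^-1 L v>]; for [x] solving [L x = D v], it turns
   [<x - v, L (x - v)> >= 0] into [<v, Q v> <= 0]. *)
Lemma form_orth_le0 v : \sum_(j in S) v j * Qa h j = 0 -> form Q v v <= 0.
Proof.
move=> vQh.
have [|||x xL] := @sym_solve L h (fun j => d j * v j) Lsym h_gt0.
- move=> k kS; under eq_bigr => j _ do rewrite mulrC Lsym.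
  rewrite La // /d divfK ?subrr // gt_eqF ?h_gt0 //.
- move=> w wL; apply: formL_eq0; rewrite /form big1 // => j jS.
  rewrite (eq_bigr (fun k => w k * L k j)) ?wL ?mulr0 // => k _.
  by rewrite Lsym mulrC.
- rewrite -{}[RHS]vQh; apply: eq_bigr => j jS.
  by rewrite /d; field; rewrite gt_eqF ?h_gt0.
have xLa j : j \in S -> \sum_(k in S) L j k * x k = d j * v j.
  by move=> jS; rewrite -xL //; apply: eq_bigr => k _; rewrite mulrC Lsym.
pose s := \sum_(j in S) d j * v j ^+ 2.
have Lvx : form L v x = s.
  by apply: eq_bigr => j jS; rewrite xLa // expr2 mulrCA.
have sE : s = \sum_(j in S) d j * x j ^+ 2 - 2 * form Q x x +
    \sum_(j in S) h j * Qa x j ^+ 2 / Qa h j.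
  rewrite /form mulr_sumr -sumrB -big_split; apply: eq_bigr => j jS /=.
  have e := xLa _ jS; rewrite La // in e.
  have -> : v j = x j - Qa x j / d j.
    by rewrite -[x j](mulKf (lt0r_neq0 (d_gt0 jS))) -[v j](mulKf (lt0r_neq0 (d_gt0 jS))) -e; ring.
  rewrite -/(Qa x j) /d; have h0 := h_gt0 jS; have q0 := Qh_gt0 jS.
  by field; rewrite !gt_eqF.
have Lxx : form L x x <= s by rewrite formL sE; have := local x; lra.
have := formL_ge0 (fun i => 1 * x i + (-1) * v i).
rewrite form_quad // [form L x v]formC // Lvx => H.
have := formL v; rewrite -/s => Hv; lra.
Qed.

End Hyperbolic.
End Forms.

Section Alexandrov.
Variables (R : realFieldType) (I : finType).
Implicit Types (a b c v : I -> R) (s C : seq (I -> R)) (S T : {set I}).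

Definition hess C S j k : R := if j == k then 0 else mper C (S :\ j :\ k).

Lemma hess_sym C S j k : hess C S j k = hess C S k j.
Proof. by rewrite /hess eq_sym !setDDl [[set j] :|: _]setUC. Qed.

Lemma hess_app C S v j : \sum_(k in S) hess C S j k * v k = mper (v :: C) (S :\ j).
Proof.
rewrite mper_cons [RHS](eq_bigl (fun k => (k \in S) && (k != j))); last first.
  by move=> k; rewrite !inE andbC.
rewrite big_mkcondr /=; apply: eq_bigr => k kS; rewrite /hess eq_sym.
by case: eqP => //= _; rewrite ?mul0r // mulrC.
Qed.

Lemma hess_form C S v b : form S (hess C S) v b = mper [:: v, b & C] S.
Proof. by apply: eq_bigr => j jS; rewrite hess_app. Qed.

(* Expanding along [h] writes the form as a positive combination of forms of
   lower order, and the induction hypothesis for these gives the hypothesis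
   [local] of [form_orth_le0]. *)
Lemma alexandrov_pos C S v b : pos (b :: C) -> #|S| = (size C).+2 ->
  mper [:: v, v & C] S * mper [:: b, b & C] S <= mper [:: v, b & C] S ^+ 2.
Proof.
elim: C S v b => [|h C IH] S v b hp cS.
  have /cards2P[x [y [xy ->]]] : #|S| == 2%N by rewrite cS.
  have dx : [set x; y] :\ x = [set y].
    by apply/setP => z; rewrite !inE; case: (eqVneq z x) => [->|] //=; rewrite (negPf xy).
  have dy : [set x; y] :\ y = [set x].
    by apply/setP => z; rewrite !inE; case: (eqVneq z y) => [->|] /=; rewrite ?orbF // eq_sym (negPf xy).
  have E u w : mper [:: u; w] [set x; y] = u x * w y + u y * w x.
    rewrite mper_cons big_setU1 ?inE //= !big_set1 !mper_cons dx dy !big_set1 !mper_nil !setDv eqxx.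
    by rewrite !mulr1.
  (* With two columns the difference of the two sides is exactly this square. *)
  by rewrite !E; have := sqr_ge0 (v x * b y - v y * b x); lra.
have [b0 h0] : (forall i, 0 < b i) /\ (forall i, 0 < h i).
  by split; apply: hp; [left | right; left].
have C0 : pos C := pos_tail (pos_tail hp).
have cSj j : j \in S -> #|S :\ j| = (size C).+2.
  by move=> jS; move: cS; rewrite (cardsD1 j) jS => -[].
have hgt0 : {in S, forall j, 0 < mper [:: h, h & C] (S :\ j)}.
  by move=> j jS; apply: mper_gt0; [do 2 apply: pos_cons => // | rewrite cSj].
have Qle0 w : \sum_(j in S) w j * mper [:: h, h & C] (S :\ j) = 0 ->
    mper [:: w, w, h & C] S <= 0.
  rewrite -hess_form => w0; apply: (@form_orth_le0 _ _ _ _ h) => //.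
  - by move=> j k; apply: hess_sym.
  - move=> j k jS kS jk; rewrite /hess (negPf jk); apply: mper_gt0.
      exact: pos_tail hp.
    by have := cSj _ jS; rewrite (cardsD1 k) !inE eq_sym jk kS => -[].
  - move=> j k jS kS; rewrite /hess; case: eqP => // _.
    by apply/mper_ge0/pos_nng/(pos_tail hp).
  - by move=> j jS; rewrite hess_app hgt0.
  - move=> u; rewrite hess_form mper_swap -[[:: u, h & C]]/([:: u] ++ h :: C).
    rewrite (mper_mid _ [:: u; u]) mper_cons; apply: ler_sum => j jS.
    rewrite !hess_app; rewrite -mulrA ler_wpM2l ?(ltW (h0 j)) // ler_pdivlMr ?hgt0 //.
    by apply: IH; [apply: pos_tail hp | rewrite cSj].
  - by rewrite -[RHS]w0; apply: eq_bigr => j jS; rewrite hess_app.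
pose q u := \sum_(j in S) u j * mper [:: h, h & C] (S :\ j).
have qb : 0 < q b.
  have /card_gt0P[i iS] : (0 < #|S|)%N by rewrite cS.
  rewrite /q (big_setD1 i) //= ltr_pwDl ?mulr_gt0 ?hgt0 //.
  by apply: sumr_ge0 => j /setD1P[_ jS]; rewrite mulr_ge0 // ltW ?hgt0.
(* This combination of [v] and [b] lies in the hyperplane [q = 0], where [Qle0] applies. *)
have q0 : q (fun i => q b * v i + (- q v) * b i) = 0.
  have lin x y u w : q (fun i => x * u i + y * w i) = x * q u + y * q w.
    rewrite /q !mulr_sumr -big_split; apply: eq_bigr => j _ /=; ring.
  by rewrite lin; ring.
have := Qle0 _ q0.
rewrite -!hess_form form_quad; last by move=> j k; apply: hess_sym.
rewrite !hess_form.
have : 0 < mper [:: b, b, h & C] S.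
  by apply: mper_gt0; [do 2 apply: pos_cons => //; exact: pos_tail hp | rewrite cS].
set X := mper [:: b, b & _] _; set Y := mper [:: v, v & _] _.
set Z := mper _ _ => X0 le0.
(* Completing the square: multiply the inequality by [X > 0] and discard the square of
   [q v * X - q b * Z]. *)
have : (q b) ^+ 2 * (Y * X - Z ^+ 2) <= 0.
  rewrite [leLHS](_ : _ = X * ((q b) ^+ 2 * Y + q b * - q v * Z *+ 2 +
    (- q v) ^+ 2 * X) - (q v * X - q b * Z) ^+ 2); last by ring.
  by rewrite subr_le0 (le_trans _ (sqr_ge0 _)) // mulr_ge0_le0 // ltW.
by rewrite pmulr_rle0 ?exprn_gt0 // subr_le0.
Qed.

End Alexandrov.

(** * Gurvits' inequality *)

(** Stands in for the limit of [e] to 0: if [y < x], the [e] chosen below makes [e * K] at most half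
    of the gap. *)
Lemma le_linear_perturb (R : realFieldType) (x y K : R) :
  (forall e : R, 0 < e -> e <= 1 -> x <= y + e * K) -> x <= y.
Proof.
move=> H; rewrite leNgt; apply/negP => yx.
have d0 : 0 < x - y by rewrite subr_gt0.
have K0 : 0 < K by have := H 1 ltr01 (lexx _); lra.
pose e := Num.min 1 ((x - y) / (2 * K)).
have e0 : 0 < e by rewrite lt_min ltr01 divr_gt0 // mulr_gt0.
have := H e e0; rewrite {1}/e ge_min lexx => /(_ isT) h.
have : e * K <= (x - y) / 2.
  rewrite (_ : (x - y) / 2 = (x - y) / (2 * K) * K); last by field; rewrite gt_eqF.
  by rewrite ler_wpM2r ?(ltW K0) // /e ge_min lexx orbT.
lra.
Qed.

(** * Passage from positive to nonnegative rows *)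

Section Perturbation.
Variables (R : realFieldType) (I : finType).
Implicit Types (a b c : I -> R) (s C : seq (I -> R)) (S T : {set I}).

Definition shift (e : R) a : I -> R := fun i => a i + e.

Lemma pos_shift (e : R) s : 0 < e -> nng s -> pos (map (shift e) s).
Proof.
move=> e0; elim: s => [_ a []|a s IH h] /=; apply: pos_cons.
  by move=> i; apply: ltr_wpDl => //; apply: h; left.
exact: (IH (nng_tail h)).
Qed.

Lemma mper_shift_ge (e : R) s S : 0 <= e -> nng s -> mper s S <= mper (map (shift e) s) S.
Proof.
move=> e0; elim: s S => //= a s IH S h; rewrite !mper_cons.
have a0 i : 0 <= a i by apply: h; left.
have h' := nng_tail h.
apply: ler_sum => i _; apply: ler_pM => //; rewrite ?mper_ge0 ?IH //.
by rewrite lerDl.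
Qed.

Lemma mper_shift_le s : nng s ->
  exists K : R, 0 <= K /\ forall S (e : R), 0 <= e -> e <= 1 ->
    mper (map (shift e) s) S <= mper s S + e * K.
Proof.
elim: s => [|a s IH] h /=.
  by exists 0; split=> // S e _ _; rewrite mulr0 addr0.
have a0 i : 0 <= a i by apply: h; left.
have h' := nng_tail h; have [K [K0 HK]] := IH h'.
pose G S := \sum_(i in S) (mper s (S :\ i) + K * a i + K).
have G0 S : 0 <= G S.
  by apply: sumr_ge0 => i _; rewrite !addr_ge0 ?mulr_ge0 ?mper_ge0.
(* [G S] serves one set of columns; the sum over all sets gives a constant independent of [S], as
   the induction through [S :\ i] needs. *)
exists (\sum_S G S); split; first exact: sumr_ge0.
move=> S e e0 e1; apply: le_trans (_ : _ <= mper (a :: s) S + e * G S) _; last first.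
  rewrite lerD2l ler_wpM2l // (bigD1 S) //= lerDl; exact: sumr_ge0.
rewrite !mper_cons mulr_sumr -big_split; apply: ler_sum => i _ /=.
apply: le_trans (_ : _ <= (a i + e) * (mper s (S :\ i) + e * K)) _.
  by rewrite ler_wpM2l ?addr_ge0 // HK.
have : e * e * K <= e * K by rewrite ler_wpM2r // ler_piMl.
lra.
Qed.

Lemma alexandrov S C a b : nng [:: a, b & C] -> #|S| = (size C).+2 ->
  mper [:: a, a & C] S * mper [:: b, b & C] S <= mper [:: a, b & C] S ^+ 2.
Proof.
move=> h cS; have [K [K0 HK]] := mper_shift_le h.
set y := mper [:: a, b & C] S in HK *.
have y0 : 0 <= y by apply: (mper_ge0 _ h).
(* For [e <= 1], [(y + e * K) ^+ 2] exceeds [y ^+ 2] by at most [e] times this constant. *)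
apply: (@le_linear_perturb _ _ _ (2 * y * K + K ^+ 2)) => e e0 e1.
have hC : nng C := nng_tail (nng_tail h).
have [a0 b0] : (forall i, 0 <= a i) /\ (forall i, 0 <= b i).
  by split; apply: h; [left | right; left].
have haa : nng [:: a, a & C] by do 2 apply: nng_cons => //.
have hbb : nng [:: b, b & C] by do 2 apply: nng_cons => //.
have := mper_shift_ge S (ltW e0) haa; have := mper_shift_ge S (ltW e0) hbb => /=.
have pb : pos (map (shift e) (b :: C)) by apply: pos_shift => //; apply: nng_tail h.
have := @alexandrov_pos _ _ _ S (shift e a) _ pb; rewrite size_map => /(_ cS).
have := HK S e (ltW e0) e1 => /=.
set Y := mper [:: shift e a, shift e b & _] S.
set A := mper [:: shift e a, shift e a & _] S.
set B := mper [:: shift e b, shift e b & _] S => YK AB leB leA.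
apply: le_trans (_ : _ <= A * B) _; first by rewrite ler_pM ?mper_ge0.
apply: (le_trans AB); apply: le_trans (_ : _ <= (y + e * K) ^+ 2) _.
  have Y0 : 0 <= Y by apply: (le_trans y0 (mper_shift_ge S (ltW e0) h)).
  by rewrite ler_pXn2r ?nnegrE // addr_ge0 // mulr_ge0 // ltW.
have : e * e * K ^+ 2 <= e * K ^+ 2 by rewrite ler_wpM2r ?sqr_ge0 // ler_piMl // ltW.
lra.
Qed.

End Perturbation.

Lemma log_concave_geometric (R : realFieldType) (F : nat -> R) (m : nat) :
    (forall k, (k <= m)%N -> 0 < F k) ->
    (forall k, (k.+2 <= m)%N -> F k.+2 * F k <= F k.+1 ^+ 2) ->
  F m <= F 0%N * (F 1%N / F 0%N) ^+ m.
Proof.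
move=> F0 lc; set q := F 1%N / F 0%N.
(* For [m = 0] nothing is known about [F 1], so the sign of [q] is available only for positive
   [m]. *)
have q0 : (0 < m)%N -> 0 <= q by move=> m0; rewrite divr_ge0 // ltW ?F0.
have ratio k : (k < m)%N -> F k.+1 <= q * F k.
  elim: k => [|k IH] km; first by rewrite /q divfK // gt_eqF ?F0.
  have Fk := F0 _ (ltnW (ltnW km)).
  rewrite -(ler_pM2r Fk) (le_trans (lc _ km)) // expr2 mulrAC ler_wpM2r //.
    by rewrite ltW ?F0 // ltnW.
  exact/IH/ltnW.
have : forall k, (k <= m)%N -> F k <= F 0%N * q ^+ k.
  elim=> [|k IH] km; first by rewrite expr0 mulr1.
  rewrite (le_trans (ratio _ km)) // exprS mulrCA ler_wpM2l ?IH 1?ltnW //.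
  by apply: q0; apply: leq_ltn_trans km.
by apply.
Qed.

Section Gurvits.
Variables (R : realFieldType) (I : finType).
Implicit Types (y z b : I -> R) (C : seq (I -> R)) (S : {set I}).

(** By Alexandrov's inequality the permanent with [k] rows [z] and [m.+1 - k] rows [y] is
    log-concave in [k], so it grows at most geometrically with its first ratio. *)
Lemma mper_nseq_le y z C S m : pos [:: y, z & C] -> #|S| = (m.+1 + size C)%N ->
  mper (nseq m.+1 z ++ C) S <= mper (nseq m.+1 y ++ C) S *
   (mper (z :: nseq m y ++ C) S / mper (nseq m.+1 y ++ C) S) ^+ m.+1.
Proof.
move=> h cS; pose F k := mper (nseq k z ++ nseq (m.+1 - k) y ++ C) S.
have y0 i : 0 < y i by apply: h; left.
have z0 i : 0 < z i by apply: h; right; left.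
have C0 : pos C := pos_tail (pos_tail h).
have -> : mper (nseq m.+1 z ++ C) S = F m.+1 by rewrite /F subnn.
have -> : mper (nseq m.+1 y ++ C) S = F 0%N by rewrite /F subn0.
have -> : mper (z :: nseq m y ++ C) S = F 1%N by rewrite /F subSS subn0.
apply: log_concave_geometric.
  move=> k km; apply: mper_gt0; first by do 2 (apply: pos_cat; first exact: pos_nseq).
  by rewrite cS !size_cat !size_nseq addnA subnKC.
move=> k km; rewrite /F; have -> : (m.+1 - k = (m.+1 - k.+2).+2)%N by lia.
have -> : (m.+1 - k.+1 = (m.+1 - k.+2).+1)%N by lia.
set r := (m.+1 - _)%N; pose rest := nseq k z ++ nseq r y ++ C.
have -> : mper (nseq k z ++ nseq r.+2 y ++ C) S = mper [:: y, y & rest] S.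
  exact: etrans (mper_mid y (nseq k z) (y :: nseq r y ++ C) S)
    (mper_mid y (y :: nseq k z) (nseq r y ++ C) S).
have -> : mper (nseq k.+1 z ++ nseq r.+1 y ++ C) S = mper [:: z, y & rest] S.
  exact: etrans (mper_mid y (z :: nseq k z) (nseq r y ++ C) S) (mper_swap _ _ _ _).
apply: alexandrov.
  apply: pos_nng; do 2 apply: pos_cons => //.
  by do 2 (apply: pos_cat; first exact: pos_nseq).
by rewrite cS !size_cat !size_nseq /r; lia.
Qed.

(* [C] collects the rows already split off from the product
   [\prod_i \sum_j x j * f j i]; each step splits off one more. *)
Lemma gurvits_pos (J : eqType) (f : J -> I -> R) (t : seq J) C S (kap : R) :
    (forall j i, 0 < f j i) -> pos C -> uniq t -> #|S| = (size t + size C)%N ->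
    (forall x : J -> R, (forall j, 0 < x j) ->
       kap * \prod_(j <- t) x j * (size t)`!%:R <=
       mper (nseq (size t) (fun i => \sum_(j <- t) x j * f j i) ++ C) S) ->
  kap * (size t)`!%:R / (size t)%:R ^+ size t <= mper (map f t ++ C) S.
Proof.
move=> f0; elim: t C kap => [|j t IH] C kap C0.
  move=> _ _ /(_ (fun=> 1) (fun=> ltr01)) /=.
  by rewrite big_nil fact0 expr0 divr1 !mulr1.
move=> /= /andP[jt ut] cS H; rewrite -mper_mid.
have bigt (h : J -> R -> R) (x : J -> R) u :
    \sum_(k <- t) h k (if k == j then u else x k) = \sum_(k <- t) h k (x k).
  rewrite !big_seq; apply: eq_bigr => k kt.
  by case: eqP => // kj; rewrite -kj kt in jt.
have prodt (x : J -> R) u :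
    \prod_(k <- t) (if k == j then u else x k) = \prod_(k <- t) x k.
  rewrite !big_seq; apply: eq_bigr => k kt.
  by case: eqP => // kj; rewrite -kj kt in jt.
(* A single remaining row is separate: the sum [y] over [t] would be zero and the later choice of
   [u] would divide by 0. *)
case: (posnP (size t)) => [/size0nil t0|m0].
  subst t; have := H (fun=> 1) (fun=> ltr01).
  rewrite /= big_seq1 expr1 divr1 mulr1 (_ : 1`!%:R = 1) // !mulr1.
  rewrite (_ : (fun i => \sum_(k <- [:: j]) 1 * f k i) = f j) //.
  by apply/funext => i; rewrite big_seq1 mul1r.
set m := size t in m0 cS H *.
have mR : 0 < m%:R :> R by rewrite ltr0n.
have mR' : 0 < m.+1%:R :> R by rewrite ltr0n.
(* Splitting off one row costs the factor [(m / m.+1) ^ m]; over all rows these factors multiply to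
   the van der Waerden constant. *)
pose kap' := kap * m.+1%:R * m%:R ^+ m / m.+1%:R ^+ m.+1.
have -> : kap * m.+1`!%:R / m.+1%:R ^+ m.+1 = kap' * m`!%:R / m%:R ^+ m.
  rewrite /kap' factS natrM; field.
  by rewrite !expf_eq0 !gt_eqF // !andbF.
apply: IH => //.
- by apply: pos_cons.
- by rewrite cS /= addSnnS.
move=> x x0; rewrite -/m.
pose y i := \sum_(k <- t) x k * f k i.
have y0 i : 0 < y i.
  rewrite /y; move: (m0 : (0 < size t)%N); case: (t) => // k u _; rewrite big_cons ltr_pwDl ?mulr_gt0 //.
  by apply: sumr_ge0 => l _; rewrite ltW ?mulr_gt0.
set X := \prod_(k <- t) x k.
rewrite mper_mid -/y.
set B := mper (f j :: nseq m y ++ C) S.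
set F := mper (nseq m.+1 y ++ C) S.
have posyC : pos (nseq m y ++ C) by apply: pos_cat; first exact: pos_nseq.
have F0 : 0 < F.
  by apply: mper_gt0; [apply: pos_cons | rewrite cS size_cat size_nseq].
have B0 : 0 < B.
  by apply: mper_gt0; [apply: pos_cons | rewrite cS /= size_cat size_nseq].
(* Weight [u] on row [j] turns the hypothesis into a bound on [m.+1] copies of [y + u * f j], which
   [mper_nseq_le] controls by the linear term [B]. *)
have step u : 0 < u -> kap * (u * X) * m.+1`!%:R <= F * (1 + u * B / F) ^+ m.+1.
  move=> u0; have := H (fun k => if k == j then u else x k).
  have h0 k : 0 < (if k == j then u else x k) by case: eqP.
  move=> /(_ h0); rewrite big_cons eqxx prodt => /le_trans; apply.
  set z := fun i => _; have zE : z = fun i => y i + u * f j i.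
    apply/funext => i; rewrite /z big_cons eqxx addrC.
    by rewrite (bigt (fun k a => a * f k i)).
  apply: le_trans (@mper_nseq_le y z C S m _ _) _.
  - apply: pos_cons => //; apply: pos_cons => // i.
    by rewrite zE ltr_wpDr ?y0 // mulr_ge0 ?ltW.
  - by rewrite cS.
  rewrite -/F zE mperD mperZ -/B -[mper (y :: _) S]/F.
  by rewrite mulrDl divff ?gt_eqF.
(* This [u] minimizes [(1 + u * B / F) ^+ m.+1 / u]. *)
have := step (F / (m%:R * B)) (divr_gt0 F0 (mulr_gt0 mR B0)).
have -> : 1 + F / (m%:R * B) * B / F = m.+1%:R / m%:R.
  by rewrite -natr1; field; rewrite !gt_eqF.
set c := m%:R * B / F * (m%:R ^+ m / m.+1%:R ^+ m.+1).
have nz : m%:R ^+ m != 0 :> R by rewrite expf_neq0 ?gt_eqF.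
have nz' : m.+1%:R ^+ m.+1 != 0 :> R by rewrite expf_neq0 ?gt_eqF.
have c0 : 0 <= c.
  by rewrite /c mulr_ge0 ?divr_ge0 ?exprn_ge0 ?ler0n ?mulr_ge0 ?ler0n // ltW.
move=> /(ler_wpM2r c0).
rewrite [leLHS](_ : _ = kap' * X * m`!%:R); last first.
  by rewrite /c /kap' factS natrM; field; rewrite nz' !gt_eqF.
rewrite [leRHS](_ : _ = B) // /c expr_div_n [m%:R ^+ m.+1]exprS; field.
by rewrite nz nz' !gt_eqF.
Qed.

(** With no row split off, all rows of the mixed permanent equal the same combination, and
    [mper_nseq] turns it into the product of column sums. Zero entries are handled by a shift. *)
Lemma gurvits (J : eqType) (f : J -> I -> R) (t : seq J) S (kap : R) :
    (forall j i, 0 <= f j i) -> uniq t -> #|S| = size t ->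
    (forall x : J -> R, (forall j, 0 < x j) ->
       kap * \prod_(j <- t) x j <= \prod_(i in S) \sum_(j <- t) x j * f j i) ->
  kap * (size t)`!%:R / (size t)%:R ^+ size t <= mper (map f t) S.
Proof.
move=> f0 ut cS H; have hf : nng (map f t) by apply: nng_map.
have [K [K0 HK]] := mper_shift_le hf.
apply: (@le_linear_perturb _ _ _ K) => e e0 e1.
apply: le_trans (HK S e (ltW e0) e1); rewrite -map_comp -[map _ t]cats0.
apply: gurvits_pos => //.
- by move=> j i; apply: ltr_wpDl.
- by rewrite cS addn0.
move=> x x0; rewrite cats0 mper_nseq // mulrC ler_wpM2l ?ler0n //.
apply: le_trans (H x x0) _; apply: ler_prod => i _; apply/andP; split.
  by apply: sumr_ge0 => j _; rewrite mulr_ge0 // ltW.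
by apply: ler_sum => j _; rewrite ler_wpM2l ?(ltW (x0 j)) // /shift /= lerDl ltW.
Qed.

End Gurvits.

(** * A lower bound on the capacity *)

(** Summation by parts: as the weights decrease, the last weight times the full partial sum stays
    below the weighted sum. *)
Lemma abel_sum_ge0 (R : realDomainType) (k : nat) (w e : nat -> R) :
    (forall m, (m <= k)%N -> 0 <= \sum_(i < m) e i) ->
    (forall i, (i < k)%N -> 0 <= w i) ->
    (forall i, (i.+1 < k)%N -> w i.+1 <= w i) ->
  0 <= \sum_(i < k) w i * e i.
Proof.
move=> e0 w0 wle; case: k e0 w0 wle => [|k] e0 w0 wle; first by rewrite big_ord0.
suff H m : (m < k.+1)%N -> w m * \sum_(i < m.+1) e i <= \sum_(i < m.+1) w i * e i.
  by apply: le_trans (H k (ltnSn k)); rewrite mulr_ge0 ?w0 ?e0.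
elim: m => [|m IH] mk; first by rewrite !big_ord_recr !big_ord0 /= !add0r.
rewrite big_ord_recr [leRHS]big_ord_recr /= mulrDr lerD2r.
apply: le_trans (IH (ltnW mk)); rewrite ler_wpM2r ?wle //.
exact/e0/ltnW.
Qed.

Lemma sorted_enum (R : realDomainType) (J : finType) (A : {set J}) (g : J -> R) (x0 : J) :
  exists s : seq J, [/\ uniq s, s =i A, size s = #|A| &
    forall l, (l.+1 < size s)%N -> g (nth x0 s l.+1) <= g (nth x0 s l)].
Proof.
pose r : rel J := fun i j => g j <= g i.
have rtot : total r by move=> i j; apply: le_total.
exists (sort r (enum A)); split.
- by rewrite sort_uniq enum_uniq.
- by move=> i; rewrite mem_sort mem_enum.
- by rewrite size_sort -cardE.
by move=> l ls; apply: (sortedP x0 (sort_sorted rtot (enum A))).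
Qed.

Lemma big_nth_take (R : Type) (idx : R) (op : Monoid.com_law idx)
    (J : finType) (s : seq J) (x0 : J) L (F : J -> R) :
    uniq s -> (L <= size s)%N ->
  \big[op/idx]_(j in [set j in take L s]) F j = \big[op/idx]_(l < L) F (nth x0 s l).
Proof.
move=> us Ls; rewrite (eq_bigl (mem (take L s))); last by move=> j; rewrite !inE.
rewrite -big_uniq ?take_uniq //= (big_nth x0) size_takel // big_mkord.
by apply: eq_bigr => l _; rewrite nth_take.
Qed.

(** A corner of size [L] by [M] in a square of order [k] meets the antidiagonal only when [L + M]
    exceeds [k]; the truncated subtraction covers both cases. *)
Lemma antidiagonal_count k L M : (L <= k)%N -> (M <= k)%N ->
  (\sum_(m < M) \sum_(l < L) (l + m == k.-1) <= L + M - k)%N.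
Proof.
move=> Lk; elim: M => [|M IH] Mk; first by rewrite big_ord0.
rewrite big_ord_recr /=.
have inner : (\sum_(l < L) (l + M == k.-1) <= (k <= L + M))%N.
  clear IH; elim: (L) => [|l IH]; first by rewrite big_ord0.
  rewrite big_ord_recr /=; move: IH.
  by case: (eqVneq (l + M)%N k.-1); case: (leqP k (l + M)); case: (leqP k (l.+1 + M)) => /= *; lia.
have := IH (ltnW Mk); move: inner.
by case: (leqP k (L + M)) => /= *; lia.
Qed.

Section Majorization.
Variables (R : realFieldType) (I J : finType).

(* Sorting the rows by [x] and the columns by their weighted sums [y], the
   hypothesis makes all corner sums of [a - tau * (antidiagonal)] nonnegative;
   two Abel summations and AM-GM conclude. *)
Lemma capacity_ge (a : J -> I -> R) (A : {set J}) (S : {set I}) (tau : R) (x : J -> R) :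
    #|A| = #|S| -> 0 < tau -> (forall j i, 0 <= a j i) -> (forall j, 0 < x j) ->
    (forall (A' : {set J}) (S' : {set I}), A' \subset A -> S' \subset S ->
       tau * (#|A'| + #|S'| - #|S|)%N%:R <= \sum_(j in A') \sum_(i in S') a j i) ->
  tau ^+ #|S| * \prod_(j in A) x j <= \prod_(i in S) \sum_(j in A) x j * a j i.
Proof.
move=> cAS t0 a0 x0 H; set k := #|S| in cAS H *.
case: (posnP k) => [k0|k0].
  have -> : A = set0 by apply: cards0_eq; rewrite cAS.
  have -> : S = set0 by apply: cards0_eq.
  by rewrite k0 !big_set0 mulr1.
have /card_gt0P[j0 j0A] : (0 < #|A|)%N by rewrite cAS.
have /card_gt0P[i0 i0S] : (0 < #|S|)%N by [].
pose y i := \sum_(j in A) x j * a j i.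
have y0 i : i \in S -> 0 < y i.
  move=> iS; have := H A [set i] (subxx _); rewrite sub1set => /(_ iS).
  rewrite cards1 cAS addKn mulr1 => h.
  have [j jA aj] : exists2 j, j \in A & 0 < a j i.
    apply/exists_inP; apply: contraLR (lt_le_trans t0 h).
    rewrite negb_exists_in => /forall_inP aj; rewrite -leNgt.
    by apply: sumr_le0 => j jA; rewrite big_set1 leNgt aj.
  rewrite /y (bigD1 j) //= ltr_pwDl ?mulr_gt0 //.
  by apply: sumr_ge0 => l _; rewrite mulr_ge0 // ltW.
have [s [us sA sz_s s_le]] := sorted_enum A x j0.
have [t [ut tS sz_t t_le]] := sorted_enum S (fun i => (y i)^-1) i0.
pose X l := x (nth j0 s l); pose W m := (y (nth i0 t m))^-1.
pose a' l m := a (nth j0 s l) (nth i0 t m).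
have sAE : A = [set j in take k s].
  by apply/setP => j; rewrite inE take_oversize ?sA // sz_s cAS.
have tSE : S = [set j in take k t].
  by apply/setP => j; rewrite inE take_oversize ?tS // sz_t.
have W0 m : (m < k)%N -> 0 < W m.
  by move=> mk; rewrite invr_gt0 y0 // -tS mem_nth // sz_t.
pose dl l m : R := (l + m == k.-1)%N%:R.
have corner L M : (L <= k)%N -> (M <= k)%N ->
    0 <= \sum_(l < L) \sum_(m < M) (a' l m - tau * dl l m).
  move=> Lk Mk; under eq_bigr do rewrite sumrB; rewrite sumrB subr_ge0.
  have := H [set j in take L s] [set i in take M t].
  have sub1 : [set j in take L s] \subset A.
    by apply/subsetP => j; rewrite inE => /mem_take; rewrite sA.
  have sub2 : [set i in take M t] \subset S.
    by apply/subsetP => j; rewrite inE => /mem_take; rewrite tS.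
  move=> /(_ sub1 sub2).
  have -> : #|[set j in take L s]| = L.
    by rewrite cardsE (card_uniqP _) ?take_uniq // size_takel // sz_s cAS.
  have -> : #|[set j in take M t]| = M.
    by rewrite cardsE (card_uniqP _) ?take_uniq // size_takel // sz_t.
  rewrite (big_nth_take _ j0) ?sz_s ?cAS //.
  under [X in _ <= X -> _]eq_bigr do rewrite (big_nth_take _ i0) ?sz_t //.
  apply: le_trans; under eq_bigr do rewrite -mulr_sumr; rewrite -mulr_sumr.
  rewrite ler_pM2l // exchange_big /=.
  under eq_bigr do rewrite -natr_sum.
  by rewrite -natr_sum ler_nat antidiagonal_count.
have main : 0 <= \sum_(m < k) W m * \sum_(l < k) X l * (a' l m - tau * dl l m).
  apply: (@abel_sum_ge0 _ k W (fun m => \sum_(l < k) X l * (a' l m - tau * dl l m))).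
  - move=> M Mk; rewrite exchange_big /=; under eq_bigr do rewrite -mulr_sumr.
    apply: (@abel_sum_ge0 _ k X (fun l => \sum_(m < M) (a' l m - tau * dl l m))).
    + by move=> L Lk; apply: corner.
    + by move=> l _; apply/ltW/x0.
    + by move=> l lk; apply: s_le; rewrite sz_s cAS.
  - by move=> m mk; rewrite ltW ?W0.
  - by move=> m mk; apply: t_le; rewrite sz_t.
have yE m : (m < k)%N -> y (nth i0 t m) = \sum_(l < k) X l * a' l m.
  by move=> mk; rewrite /y sAE (big_nth_take _ j0) // sz_s cAS.
have rev_lt m : (m < k)%N -> (k.-1 - m < k)%N by lia.
(* In [main] each column contributes [W m] times its weighted sum, which is 1, minus the one
   antidiagonal term with [l = k.-1 - m]. *)
have le1 : \sum_(m < k) tau * (W m * X (k.-1 - m)%N) <= k%:R.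
  rewrite -subr_ge0; apply: (le_trans main).
  have -> : k%:R = \sum_(m < k) (1 : R) by rewrite sumr_const card_ord.
  rewrite -sumrB; apply: ler_sum => m _.
  under eq_bigr do rewrite mulrBr.
  rewrite sumrB -yE // mulrBr mulVf; last by rewrite gt_eqF // -invr_gt0 W0.
  rewrite lerD2l lerN2 (bigD1 (Ordinal (rev_lt _ (ltn_ord m)))) //= big1 ?addr0.
    rewrite /dl subnK ?eqxx; [|by have := ltn_ord m; lia].
    rewrite mulr1; lra.
  move=> l ne; rewrite /dl (_ : (_ == _)%N = false) ?mulr0 //.
  apply/negbTE; apply: contraNneq ne => e; apply/eqP/val_inj => /=; lia.
have W1 (m : 'I_k) : 0 <= tau * (W m * X (k.-1 - m)%N).
  by apply/ltW/mulr_gt0 => //; apply/mulr_gt0; [apply: W0 | apply: x0].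
have prodle : \prod_(m < k) (tau * (W m * X (k.-1 - m)%N)) <= 1.
  have := @leif_AGM R 'I_k predT (fun m => tau * (W m * X (k.-1 - m)%N)).
  move=> [| le _]; first by move=> m _; apply: W1.
  apply: le_trans le _; rewrite card_ord exprn_ile1 //.
    by rewrite divr_ge0 // sumr_ge0.
  by rewrite ler_pdivrMr ?ltr0n // mul1r.
rewrite !big_split /= prodr_const card_ord in prodle.
have prodW : \prod_(m < k) W m = (\prod_(i in S) y i)^-1.
  by rewrite prodfV [in RHS]tSE (big_nth_take _ i0) // sz_t.
have prodX : \prod_(m < k) X (k.-1 - m)%N = \prod_(j in A) x j.
  rewrite sAE (big_nth_take _ j0) ?sz_s ?cAS // [RHS](reindex_inj rev_ord_inj) /=.
  by apply: eq_bigr => m _; rewrite /X; congr (x (nth _ _ _)); lia.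
have y_gt0 : 0 < \prod_(i in S) y i by apply: prodr_gt0.
by move: prodle; rewrite prodW prodX mulrCA mulrC ler_pdivrMr // mul1r.
Qed.

End Majorization.

(** * Numerical bounds *)

(** Checked by computation at 17; it fails at 16. The induction step reduces to [n ^ p <= n.+1 ^ p]
    with [n = p + 4]. *)
Lemma fact_lt_pow n : (17 <= n)%N -> (25 * n ^ 4 * n`! <= n ^ n)%N.
Proof.
elim: n => // n IH; rewrite leq_eqVlt => /orP[/eqP <-|].
  rewrite !factS !expnS expn0 fact0.
  lia.
rewrite ltnS => n17; have {}IH := IH n17.
have n4 : (0 < n ^ 4)%N by rewrite expn_gt0; lia.
rewrite -(leq_pmul2r n4) factS [(n.+1 ^ n.+1)%N]expnS.
have -> : (25 * n.+1 ^ 4 * (n.+1 * n`!) * n ^ 4 =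
  n.+1 * (n.+1 ^ 4 * (25 * n ^ 4 * n`!)))%N by lia.
rewrite -[leqRHS]mulnA leq_mul2l /=; apply: leq_trans (_ : n.+1 ^ 4 * n ^ n <= _)%N.
  by rewrite leq_mul2l IH orbT.
have [p pE] : exists p, n = (p + 4)%N by exists (n - 4)%N; lia.
have e1 : (n ^ n = n ^ p * n ^ 4)%N by rewrite -expnD -pE.
have e2 : (n.+1 ^ n = n.+1 ^ p * n.+1 ^ 4)%N by rewrite -expnD -pE.
have h : (n ^ p <= n.+1 ^ p)%N by case: (p) => // q; rewrite leq_exp2r.
by have := leq_mul h (leqnn (n.+1 ^ 4 * n ^ 4)); rewrite e1 e2; lia.
Qed.

(* The two neighbours of this term in the binomial expansion are each at least
   half of it. *)
Lemma binomial_mode_le k m :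
  (2 * ('C(k.+1 + m.+1, k.+1) * (m.+1 ^ m.+1 * k.+1 ^ k.+1)) <=
   (m.+1 + k.+1) ^ (k.+1 + m.+1))%N.
Proof.
set n := (k.+1 + m.+1)%N.
rewrite expnDn; set F := fun i => ('C(n, i) * (m.+1 ^ (n - i) * k.+1 ^ i))%N.
have -> : (\sum_(i < n.+1) 'C(n, i) * (m.+1 ^ (n - i) * k.+1 ^ i) =
  \sum_(0 <= i < n.+1) F i)%N by rewrite big_mkord.
have sub : (F k + F k.+1 + F k.+2 <= \sum_(0 <= i < n.+1) F i)%N.
  rewrite (@big_cat_nat _ _ _ k) //=; last by rewrite /n; lia.
  rewrite (@big_ltn _ _ _ k); last by rewrite /n; lia.
  rewrite (@big_ltn _ _ _ k.+1); last by rewrite /n; lia.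
  rewrite (@big_ltn _ _ _ k.+2); last by rewrite /n; lia.
  lia.
have n1 : (n - k.+1 = m.+1)%N by rewrite /n; lia.
have n0 : (n - k = m.+2)%N by rewrite /n; lia.
have n2 : (n - k.+2 = m)%N by rewrite /n; lia.
set T := ('C(n, k.+1) * _)%N; have TE : T = F k.+1 by rewrite /T /F n1.
have lo : (m.+2 * F k = m.+1 * T)%N.
  rewrite TE /F n0 n1; have := mul_bin_left n k; rewrite n0 => e.
  rewrite mulnA -e [(m.+1 ^ m.+2)%N]expnS [(k.+1 ^ k.+1)%N]expnS; lia.
have hi : (k.+2 * F k.+2 = k.+1 * T)%N.
  rewrite TE /F n2 n1; have := mul_bin_left n k.+1; rewrite n1 => e.
  rewrite mulnA e [(k.+1 ^ k.+2)%N]expnS [(m.+1 ^ m.+1)%N]expnS; lia.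
have lo' : (T <= 2 * F k)%N by rewrite -(leq_pmul2l (ltn0Sn m.+1)); lia.
have hi' : (T <= 2 * F k.+2)%N by rewrite -(leq_pmul2l (ltn0Sn k.+1)); lia.
by lia.
Qed.

Lemma bernoulli_le (R : numDomainType) (x : R) m : 0 <= x -> 1 + m%:R * x <= (1 + x) ^+ m.
Proof.
move=> x0; elim: m => [|m IH]; first by rewrite mul0r addr0 expr0.
have x1 : 0 <= 1 + x by rewrite addr_ge0.
rewrite exprS; apply: le_trans (ler_wpM2l x1 IH); rewrite -subr_ge0.
rewrite [leRHS](_ : _ = m%:R * x ^+ 2); last by rewrite -natr1; ring.
by rewrite mulr_ge0 ?exprn_ge0.
Qed.

Lemma bernoulli_ge (R : realDomainType) (x : R) m :
  0 <= x -> x <= 1 -> 1 - m%:R * x <= (1 - x) ^+ m.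
Proof.
move=> x0 x1; elim: m => [|m IH]; first by rewrite mul0r subr0 expr0.
have x1' : 0 <= 1 - x by rewrite subr_ge0.
rewrite exprS; apply: le_trans (ler_wpM2l x1' IH); rewrite -subr_ge0.
rewrite [leRHS](_ : _ = m%:R * x ^+ 2); last by rewrite -natr1; ring.
by rewrite mulr_ge0 ?exprn_ge0.
Qed.

(** * Bounds on the van der Waerden constant and stability of the AM-GM inequality *)

Section RealBounds.
Variable R : realType.

(** For positive [n], the permanent of the uniform doubly stochastic matrix. *)
Definition vdw (n : nat) : R := n`!%:R / n%:R ^+ n.

Lemma vdw_gt0 n : 0 < vdw n.
Proof.
case: n => [|n]; first by rewrite /vdw expr0 divr1 ltr01.
by rewrite /vdw divr_gt0 ?ltr0n ?fact_gt0 // exprn_gt0.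
Qed.

(** The quotient [vdw (k + m) / (vdw k * vdw m)] is the central term of the binomial distribution
    with success probability [k / (k + m)], at most one half by [binomial_mode_le]. *)
Lemma vdw_split k m : (0 < k)%N -> (0 < m)%N -> 2 * vdw (k + m) <= vdw k * vdw m.
Proof.
case: k => // k _; case: m => // m _; have := binomial_mode_le k m.
rewrite -(ler_nat R) !natrM !natrX (addnC m.+1).
set n := (k.+1 + m.+1)%N => h.
have bin : 'C(n, k.+1)%:R * (k.+1`!%:R * m.+1`!%:R) = n`!%:R :> R.
  rewrite -!natrM -(@bin_fact n k.+1) ?leq_addr //.
  by rewrite (_ : n - k.+1 = m.+1)%N // /n; lia.
rewrite /vdw -bin.
have k0 : 0 < k.+1%:R ^+ k.+1 :> R by rewrite exprn_gt0.
have m0 : 0 < m.+1%:R ^+ m.+1 :> R by rewrite exprn_gt0.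
have n0 : 0 < n%:R ^+ n :> R by rewrite exprn_gt0 // ltr0n.
rewrite mulf_div [leLHS]mulrA ler_pdivrMr // mulrAC ler_pdivlMr ?mulr_gt0 //.
set u := _ ^+ k.+1 in h k0 *; set v := _ ^+ m.+1 in h m0 *.
set N := n%:R ^+ n in h n0 *.
have f0 : 0 <= k.+1`!%:R * m.+1`!%:R :> R by rewrite mulr_ge0.
have := ler_wpM2r f0 h; lra.
Qed.

Lemma vdw_small n : (17 <= n)%N -> 25 * n%:R ^+ 4 * vdw n <= 1.
Proof.
move=> n17; have := fact_lt_pow n17; rewrite -(ler_nat R) !natrM !natrX => h.
have n0 : 0 < n%:R ^+ n :> R by rewrite exprn_gt0 // ltr0n; lia.
by rewrite /vdw mulrA ler_pdivrMr // mul1r.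
Qed.

Lemma prod_mean1_le n (r : 'I_n -> R) : (forall i, 0 <= r i) ->
  \sum_i r i = n%:R -> \prod_i r i <= 1 ?= iff [forall i, r i == 1].
Proof.
case: n r => [|n] r r0 rs.
  by rewrite big_ord0; split=> //; rewrite eqxx; apply/esym/forallP => -[].
have := @leif_AGM R 'I_n.+1 predT r (fun i _ => r0 i).
rewrite card_ord rs divff ?pnatr_eq0 // expr1n => -[le1 eq1]; split=> //.
apply: etrans eq1 _; apply/forall_inP/forallP => [h i|h i _]; last first.
  by apply/forall_inP => j _; rewrite (eqP (h i)) (eqP (h j)).
have c j : r j = r i by apply/esym/eqP/(forall_inP (h i isT)).
have : \sum_j r j = n.+1%:R * r i.
  by rewrite (eq_bigr (fun=> r i)) ?sumr_const ?card_ord ?mulr_natl.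
rewrite rs -[LHS]mulr1 => /(mulfI _) <- //.
by rewrite pnatr_eq0.
Qed.

(* AM-GM applied to the square roots. *)
Lemma prod_mean1_stable n (r : 'I_n -> R) : (forall i, 0 <= r i) ->
    \sum_i r i = n%:R ->
  \prod_i r i * (1 + \sum_i (Num.sqrt (r i) - 1) ^+ 2) <= 1.
Proof.
case: n r => [|n] r r0 rs; first by rewrite !big_ord0 mul1r addr0.
set H := \sum_i _; set q := fun i => Num.sqrt (r i).
have q0 i : 0 <= q i by apply: sqrtr_ge0.
have qE i : q i ^+ 2 = r i by rewrite sqr_sqrtr.
have n0 : 0 < n.+1%:R :> R by rewrite ltr0n.
(* The mean of the square roots is [1 - x], by expanding the squares in [H]. *)
pose x := H / (2 * n.+1%:R).
have sq : \sum_i q i = n.+1%:R * (1 - x).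
  have HE : H = 2 * (n.+1%:R - \sum_i q i).
    rewrite /H (eq_bigr (fun i => r i - 2 * q i + 1)).
      rewrite big_split sumrB /= rs -mulr_sumr sumr_const card_ord; ring.
    by move=> i _; rewrite -/(q i) -qE; ring.
  by rewrite /x HE; field; rewrite nat1r gt_eqF.
have H0 : 0 <= H by apply: sumr_ge0 => i _; apply: sqr_ge0.
have x0 : 0 <= x by rewrite divr_ge0 // mulr_ge0 // ltW.
have x1 : 0 <= 1 - x by rewrite -(pmulr_rge0 _ n0) -sq sumr_ge0.
have [le1 _] := @leif_AGM R 'I_n.+1 predT q (fun i _ => q0 i).
rewrite card_ord sq [_ * (1 - x)]mulrC mulfK ?gt_eqF // in le1.
have -> : \prod_i r i = (\prod_i q i) ^+ 2.
  by rewrite -prodrXl; apply: eq_bigr => i _; rewrite qE.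
have bern : 1 + H <= (1 + x) ^+ (n.+1 * 2).
  apply: le_trans (bernoulli_le _ x0); rewrite natrM /x le_eqVlt; apply/orP; left.
  by apply/eqP; field; rewrite nat1r gt_eqF.
(* AM-GM gives the power of [1 - x], Bernoulli that of [1 + x]; together they form a power of
   [1 - x ^+ 2]. *)
apply: le_trans (_ : ((1 - x) ^+ n.+1) ^+ 2 * (1 + x) ^+ (n.+1 * 2) <= _).
  apply: ler_pM => //; rewrite ?sqr_ge0 ?addr_ge0 //.
  by rewrite ler_pXn2r ?nnegrE ?exprn_ge0 // prodr_ge0.
rewrite -exprM -exprMn exprn_ile1 //.
  by rewrite mulr_ge0 // addr_ge0.
by have := sqr_ge0 x; lra.
Qed.


(** [prod_mean1_stable] makes the squared deviations of the square roots of order [e]; factoring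
    [r i - 1] through the square roots and a weighted AM-GM inequality pass to the deviations
    themselves. *)
Lemma sum_deviation_le n (r : 'I_n -> R) (e : R) (S : {set 'I_n}) :
    (0 < n)%N -> (forall i, 0 <= r i) -> \sum_i r i = n%:R ->
    1 - e <= \prod_i r i -> 0 <= e -> 425 * n%:R ^+ 3 * e <= 1 ->
  `|\sum_(i in S) (r i - 1)| <= (10 * n%:R)^-1.
Proof.
move=> n_gt0 r0 rs pr e0 en.
have n0 : 1 <= n%:R :> R by rewrite ler1n.
have nn : 0 < n%:R :> R by rewrite ltr0n.
have n3 : 1 <= n%:R ^+ 3 :> R by rewrite exprn_ege1.
have e1 : 425 * e <= 1.
  by apply: le_trans en; rewrite ler_wpM2r // ler_peMr.
have := prod_mean1_stable r0 rs.
set H := \sum_i _ => stab.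
have H0 : 0 <= H by apply: sumr_ge0 => i _; apply: sqr_ge0.
have He : (1 - e) * (1 + H) <= 1.
  by apply: le_trans stab; rewrite ler_wpM2r // addr_ge0.
have He' : 424 * H <= 425 * e.
  have : 425 * e * H <= H by rewrite ler_piMl.
  lra.
have HN : 400 * n%:R ^+ 3 * H <= 1.
  have n3' : 0 <= n%:R ^+ 3 :> R by rewrite (le_trans _ n3).
  by have := ler_wpM2l n3' He'; have := mulr_ge0 n3' H0; lra.
set q := fun i => Num.sqrt (r i).
have qE i : q i ^+ 2 = r i by rewrite sqr_sqrtr.
(* Balances the two terms of [total]: with [HN] both are at most [4 * n%:R]. *)
pose lam : R := 40 * n%:R ^+ 2.
have lam0 : 0 < lam by rewrite mulr_gt0 // exprn_gt0.
have termwise i : 2 * lam * `|r i - 1| <= lam ^+ 2 * (q i - 1) ^+ 2 + (q i + 1) ^+ 2.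
  have -> : r i - 1 = (q i - 1) * (q i + 1) by rewrite -qE; ring.
  rewrite normrM -[(q i - 1) ^+ 2]real_normK ?num_real //.
  rewrite -[(q i + 1) ^+ 2]real_normK ?num_real //.
  by have := sqr_ge0 (lam * `|q i - 1| - `|q i + 1|); lra.
have total : 2 * lam * `|\sum_(i in S) (r i - 1)| <= lam ^+ 2 * H + 4 * n%:R.
  apply: le_trans (_ : 2 * lam * \sum_(i in S) `|r i - 1| <= _).
    by rewrite ler_wpM2l ?ler_norm_sum // mulr_ge0 // ltW.
  rewrite mulr_sumr; apply: le_trans (_ : \sum_i (lam ^+ 2 * (q i - 1) ^+ 2 +
      2 * (r i + 1)) <= _); last first.
    rewrite big_split /= -!mulr_sumr big_split /= rs sumr_const card_ord -/H lerD2l; lra.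
  rewrite big_mkcond /=; apply: ler_sum => i _.
  have := termwise i; have := sqr_ge0 (q i - 1); rewrite -(qE i).
  have := mulr_ge0 (sqr_ge0 lam) (sqr_ge0 (q i - 1)); have := sqr_ge0 (q i).
  by case: ifP => _; lra.
rewrite -(ler_pM2l (_ : 0 < 2 * lam)) ?mulr_gt0 //; apply: le_trans total _.
have -> : 2 * lam * (10 * n%:R)^-1 = 8 * n%:R by rewrite /lam; field; rewrite gt_eqF.
have : 4 * n%:R * (400 * n%:R ^+ 3 * H) <= 4 * n%:R * 1 by rewrite ler_wpM2l // mulr_ge0 // ltW.
rewrite /lam; lra.
Qed.

End RealBounds.

(* Pigeonhole: the [#|V|] disjoint open intervals that divide [z v0, z v1] cannot
   all contain a value of [z], since [z v0] lies in none of them. *)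
Lemma spectral_gap_set (R : realFieldType) (V : finType) (z : V -> R) (v0 v1 : V) :
    z v0 < z v1 ->
  exists U : {set V}, [/\ v1 \in U, v0 \notin U &
    forall a b, a \in U -> b \notin U -> (z v1 - z v0) / #|V|%:R <= z a - z b].
Proof.
move=> lt01; set N := #|V|.
have N0 : (0 < N)%N by apply/card_gt0P; exists v0.
have N0R : 0 < N%:R :> R by rewrite ltr0n.
set rho := (z v1 - z v0) / N%:R.
have rho0 : 0 < rho by rewrite divr_gt0 // subr_gt0.
pose P (k : 'I_N) v := (z v0 + k%:R * rho < z v) && (z v < z v0 + k.+1%:R * rho).
have [/forallP full|] := boolP [forall k, [exists v, P k v]].
  have [f Pf] : exists f, forall k, P k (f k).
    by apply: (@fin_all_exists _ (fun=> V) (fun k v => is_true (P k v))) => k; apply/existsP.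
  have mono (j k : 'I_N) : (j < k)%N -> z (f j) < z (f k).
    move=> jk; have /andP[_ h1] := Pf j; have /andP[h2 _] := Pf k.
    apply: lt_trans h1 (le_lt_trans _ h2).
    by rewrite lerD2l ler_wpM2r ?ler_nat // ltW.
  have finj : injective f.
    move=> j k e; apply/val_inj => /=; have [jk|kj|//] := ltngtP j k.
      by have := mono _ _ jk; rewrite e ltxx.
    by have := mono _ _ kj; rewrite e ltxx.
  have : (#|'I_N| <= #|predC1 v0|)%N.
    rewrite -(card_codom finj); apply/subset_leq_card/subsetP => v /codomP[k ->].
    rewrite inE; apply/eqP => e; have /andP[h _] := Pf k; move: h.
    by rewrite e ltNge lerDl mulr_ge0 // ltW.
  by rewrite card_ord cardC1 -/N; lia.
rewrite negb_forall => /existsP[k]; rewrite negb_exists => /forallP gap.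
(* The cut is made at the upper end of the empty interval. *)
exists [set v | z v0 + k.+1%:R * rho <= z v]; split.
- rewrite inE -lerBrDl; apply: le_trans (_ : N%:R * rho <= _).
    by rewrite ler_wpM2r ?(ltW rho0) // ler_nat.
  by rewrite /rho mulrCA divff ?mulr1 ?gt_eqF.
- by rewrite inE -ltNge ltrDl mulr_gt0.
move=> a b; rewrite !inE -ltNge => ha hb.
have := gap b; rewrite /P hb andbT -leNgt => hb'.
by move: ha; rewrite -natr1; lra.
Qed.

(** * Permanents and first-order perturbations *)

Section Permanent.
Variables (R : realType) (n : nat).
Implicit Types (A B : 'M[R]_n) (t : seq 'I_n) (i j k : 'I_n).

(* [s0] prescribes the permutations outside [t]. *)
Lemma mper_sum_perm A t (s0 : 'S_n) : uniq t ->
  mper [seq A i | i <- t] [set s0 i | i in t] =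
  \sum_(s : 'S_n | [forall i, (i \notin t) ==> (s i == s0 i)]) \prod_(i <- t) A i (s i).
Proof.
elim: t s0 => [|i0 t IH] s0.
  move=> _; rewrite (big_pred1 s0) ?big_nil ?mper_nil => [|s].
    by rewrite (_ : _ == _) //; apply/eqP/setP => x; rewrite inE; apply/imsetP => -[].
  apply/forallP/eqP => [h|-> i]; last by rewrite eqxx implybT.
  by apply/permP => i; apply/eqP/(implyP (h i)).
move=> /= /andP[i0t ut]; set S := [set s0 i | i in _].
have SP x : reflect (exists2 i, i \in i0 :: t & x = s0 i) (x \in S) by apply: imsetP.
have si0 : s0 i0 \in S by apply/SP; exists i0; rewrite ?mem_head.
rewrite (partition_big (fun s : 'S_n => s i0) (mem S)) /=; last first.
  move=> s /forallP h; apply/SP; exists (s0^-1%g (s i0)); last by rewrite permKV.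
  apply/negPn/negP => nt; have := h (s0^-1%g (s i0)); rewrite nt /= permKV.
  by move/eqP/perm_inj => e; rewrite e mem_head in nt.
rewrite mper_cons; apply: eq_bigr => j jS.
(* The prescription corrected to send [i0] to [j]; outside [i0 :: t] it agrees with [s0]. *)
pose s1 := (s0 * tperm (s0 i0) j)%g.
have s1E i : s1 i = tperm (s0 i0) j (s0 i) by rewrite permM.
have s1i0 : s1 i0 = j by rewrite s1E tpermL.
have [j' j't jE] := SP _ jS.
have SD : S :\ j = [set s1 i | i in t].
  apply/setP => x; rewrite !inE; apply/andP/imsetP => [[xj /SP[i it xE]]|[i it ->]].
    have [xi|xi] := eqVneq x (s0 i0).
      exists j'; last by rewrite s1E -jE tpermR.
      by move: j't; rewrite inE => /orP[/eqP e|//]; rewrite xi jE e eqxx in xj.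
    exists i; last by rewrite s1E -xE tpermD // eq_sym.
    by move: it; rewrite inE => /orP[/eqP e|//]; rewrite xE e eqxx in xi.
  split.
    by rewrite -s1i0 (inj_eq perm_inj); apply: contraNneq i0t => <-.
  rewrite s1E; case: tpermP => // _ _.
  by apply/SP; exists i => //; rewrite inE it orbT.
rewrite SD IH // mulr_sumr; apply: eq_big => [s|s].
  apply/forallP/andP => [h|[/forallP h /eqP si] i].
    have e : s i0 = j by apply/eqP; rewrite -s1i0; apply: (implyP (h i0)).
    split; last exact/eqP.
    apply/forallP => i; apply/implyP; rewrite inE negb_or => /andP[ii0 it].
    have /eqP -> := implyP (h i) it; rewrite s1E tpermD //.
      by rewrite (inj_eq perm_inj) eq_sym.
    rewrite jE (inj_eq perm_inj); apply: contraTneq j't => ->.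
    by rewrite inE negb_or ii0.
  apply/implyP => it; have [->|ii0] := eqVneq i i0; first by rewrite s1i0 si.
  have iit : i \notin i0 :: t by rewrite inE negb_or ii0.
  have /eqP -> := implyP (h i) iit; rewrite s1E tpermD //.
    by rewrite (inj_eq perm_inj) eq_sym.
  by rewrite jE (inj_eq perm_inj); apply: contraTneq j't => ->.
move=> /forallP h; rewrite big_cons; congr (A i0 _ * _).
by apply/esym/eqP; rewrite -s1i0; apply: (implyP (h i0)).
Qed.

Lemma permanentE A t : perm_eq t (enum 'I_n) ->
  permanent A = mper [seq A i | i <- t] [set: 'I_n].
Proof.
move=> te; rewrite -[map _ t]cats0 (mper_perm _ _ _ te) cats0.
have -> : [set: 'I_n] = [set (1 : 'S_n)%g i | i in enum 'I_n].
  apply/setP => x; rewrite inE; apply/esym/imsetP.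
  by exists x; rewrite ?mem_enum ?perm1.
rewrite mper_sum_perm ?enum_uniq // /permanent; apply: eq_big => [s|s _].
  by apply/esym/forallP => i; rewrite mem_enum.
by rewrite big_enum.
Qed.

Lemma permanent_tr A : permanent A^T = permanent A.
Proof.
rewrite /permanent [RHS](reindex_inj invg_inj); apply: eq_bigr => s _.
rewrite (reindex_inj (@perm_inj _ s^-1)); apply: eq_bigr => i _.
by rewrite mxE permKV.
Qed.

(** The permanent of [A] with row [i] and column [j] deleted, the cofactor of the entry [A i j]. *)
Definition pminor A i j := mper [seq A k | k <- rem i (enum 'I_n)] ([set: 'I_n] :\ j).

Lemma perm_rem_enum i : perm_eq (i :: rem i (enum 'I_n)) (enum 'I_n).
Proof. by rewrite perm_sym perm_to_rem ?mem_enum. Qed.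

Lemma permanent_row A i : permanent A = \sum_j A i j * pminor A i j.
Proof.
rewrite (permanentE A (perm_rem_enum i)) /= mper_cons.
by apply: eq_bigl => j; rewrite inE.
Qed.

Lemma permanent_delta A i j x :
  permanent (A + x *: delta_mx i j) = permanent A + x * pminor A i j.
Proof.
rewrite !(permanent_row _ i).
have E k : pminor (A + x *: delta_mx i j) i k = pminor A i k.
  congr mper; apply/eq_in_map => l; rewrite mem_rem_uniq ?enum_uniq // inE => /andP[li _].
  by apply/funext => m; rewrite !mxE (negPf li) mulr0 addr0.
under eq_bigr do rewrite E !mxE eqxx /= mulrDl.
rewrite big_split /=; congr (_ + _); rewrite (bigD1 j) //= eqxx mulr1 big1 ?addr0 //.
by move=> k /negPf ->; rewrite mulr0 mul0r.
Qed.

(** A minor is the slope of the permanent in one entry, so its symmetry follows from that of the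
    permanent. *)
Lemma pminor_tr A i j : pminor A^T j i = pminor A i j.
Proof.
apply: (addrI (permanent A)); rewrite -[pminor A i j]mul1r -permanent_delta.
by rewrite -[in LHS]permanent_tr -[pminor A^T _ _]mul1r -permanent_delta
  -[RHS]permanent_tr linearD linearZ /= trmx_delta.
Qed.

Lemma permanent_col A j : permanent A = \sum_i A i j * pminor A i j.
Proof.
rewrite -permanent_tr (permanent_row _ j); apply: eq_bigr => i _.
by rewrite mxE pminor_tr.
Qed.

Lemma permanent_ge0 A : (forall i j, 0 <= A i j) -> 0 <= permanent A.
Proof. by move=> A0; apply: sumr_ge0 => s _; apply: prodr_ge0. Qed.

Lemma row_sum_tr A i : row_sum A^T i = col_sum A i.
Proof. by apply: eq_bigr => j _; rewrite mxE. Qed.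

Lemma prod_row_delta A i j x :
  \prod_k row_sum (A + x *: delta_mx i j) k =
  \prod_k row_sum A k + x * \prod_(k | k != i) row_sum A k.
Proof.
have E k : row_sum (A + x *: delta_mx i j) k = row_sum A k + x * (k == i)%:R.
  rewrite /row_sum (eq_bigr (fun l => A k l + x * (k == i)%:R * (l == j)%:R)).
    rewrite big_split /= -mulr_sumr; congr (_ + _).
    rewrite (bigD1 j) //= eqxx big1 ?addr0 ?mulr1 // => l /negPf -> //.
  by move=> l _; rewrite !mxE -mulrA -natrM mulnb.
rewrite (bigD1 i) //= [\prod_k row_sum A k](bigD1 i) //= E eqxx mulr1 -mulrDl.
by congr (_ * _); apply: eq_bigr => k /negPf ki; rewrite E ki mulr0 addr0.
Qed.

Lemma prod_col_delta A i j x :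
  \prod_k col_sum (A + x *: delta_mx i j) k =
  \prod_k col_sum A k + x * \prod_(k | k != j) col_sum A k.
Proof.
have E := prod_row_delta A^T j i x.
rewrite -trmx_delta -linearZ -linearD /= in E.
rewrite (eq_bigr _ (fun k _ => esym (row_sum_tr _ k))) {}E; congr (_ + _ * _).
  by apply: eq_bigr => k _; rewrite row_sum_tr.
by apply: eq_bigr => k _; rewrite row_sum_tr.
Qed.

End Permanent.

(** * Existence of a maximizer *)

Section Maximizer.
Import classical_sets topology normedtype derive numFieldNormedType.Exports.
Local Open Scope classical_set_scope.
Variables (R : realType) (n : nat).

Let entry_cont (i j : 'I_n) : continuous (fun v : 'rV[R]_(n * n) => vec_mx v i j).
Proof.
rewrite (_ : (fun _ => _) = fun v : 'rV[R]_(n * n) => v 0 (mxvec_index i j)).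
  exact: coord_continuous.
by apply/funext => v; rewrite mxE.
Qed.

Let row_cont (i : 'I_n) : continuous (fun v : 'rV[R]_(n * n) => row_sum (vec_mx v) i).
Proof.
apply: continuous_big => [|j _]; last exact: entry_cont.
by move=> x; apply: add_continuous.
Qed.

Let col_cont (i : 'I_n) : continuous (fun v : 'rV[R]_(n * n) => col_sum (vec_mx v) i).
Proof.
apply: continuous_big => [|j _]; last exact: entry_cont.
by move=> x; apply: add_continuous.
Qed.

Let dittert_cont : continuous (fun v : 'rV[R]_(n * n) => dittert (vec_mx v)).
Proof.
have mc : continuous (fun x : R * R => x.1 * x.2) by exact: mul_continuous.
have ac : continuous (fun x : R * R => x.1 + x.2) by exact: add_continuous.
have rc : continuous (fun v : 'rV[R]_(n * n) => \prod_i row_sum (vec_mx v) i).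
  by apply: continuous_big => // i _; apply: row_cont.
have cc : continuous (fun v : 'rV[R]_(n * n) => \prod_i col_sum (vec_mx v) i).
  by apply: continuous_big => // i _; apply: col_cont.
have pc : continuous (fun v : 'rV[R]_(n * n) => permanent (vec_mx v)).
  apply: continuous_big => // s _.
  by apply: continuous_big => // i _; apply: entry_cont.
move=> v; have rcv := continuousD (V := R^o) (rc v) (cc v).
exact: (continuousB (V := R^o) rcv (pc v)).
Qed.

(** Flattened to row vectors, [Kset] is a closed subset of the cube of side [n%:R], hence compact,
    and [dittert] is continuous. *)
Lemma dittert_max_exists (A0 : 'M[R]_n) : Kset A0 ->
  exists A : 'M[R]_n, Kset A /\ forall B : 'M[R]_n, Kset B -> dittert B <= dittert A.
Proof.
move=> KA0; pose K := [set v : 'rV[R]_(n * n) | Kset (vec_mx v)].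
have closedK : closed K.
  have -> : K = \bigcap_(ij in [set: 'I_n * 'I_n])
      ((fun v => vec_mx v ij.1 ij.2) @^-1` [set x | 0 <= x]) `&`
      ((fun v => \sum_i row_sum (vec_mx v) i) @^-1` [set x | x = n%:R]).
    apply/seteqP; split=> v /=.
      by move=> [v0 vs]; split=> // ij _; apply: v0.
    by move=> [v0 vs]; split=> // i j; apply: (v0 (i, j)).
  apply: closedI.
    apply: closed_bigI => ij _; apply: preimage_closed; last exact: closed_ge.
    by move=> v _; apply: entry_cont.
  apply: preimage_closed; last exact: closed_eq.
  move=> v _; apply: continuous_big => [|i _]; last exact: row_cont.
  by move=> x; apply: add_continuous.
have compactK : compact K.
  have box := @rV_compact R (n * n) (fun=> `[0, n%:R]%classic)
    (fun=> @segment_compact R 0 n%:R).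
  apply: subclosed_compact closedK box _.
  move=> v [v0 vs] k; case/mxvec_indexP: k => i j.
  have vij : v ord0 (mxvec_index i j) = vec_mx v i j by rewrite mxE.
  rewrite /= in_itv /= vij v0 /= -vs (bigD1 i) //= (bigD1 j) //= -addrA lerDl.
  rewrite addr_ge0 //; first by apply: sumr_ge0.
  by apply: sumr_ge0 => l _; apply: sumr_ge0.
have [||v vK vmax] := @compact_EVT_max _ R (fun v => dittert (vec_mx v)) K _ compactK.
- by exists (mxvec A0); rewrite /K /= mxvecK.
- by apply: continuous_subspaceT; apply: dittert_cont.
exists (vec_mx v); split; first by move: vK; rewrite inE.
by move=> B KB; have := vmax (mxvec B); rewrite inE /K /= mxvecK => /(_ KB).
Qed.

End Maximizer.

(** * First-order conditions *)

Lemma row_sum_scale (R : realType) n (x : R) (A : 'M[R]_n) i :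
  row_sum (x *: A) i = x * row_sum A i.
Proof. by rewrite /row_sum mulr_sumr; apply: eq_bigr => j _; rewrite mxE. Qed.

Lemma col_sum_scale (R : realType) n (x : R) (A : 'M[R]_n) j :
  col_sum (x *: A) j = x * col_sum A j.
Proof. by rewrite /col_sum mulr_sumr; apply: eq_bigr => i _; rewrite mxE. Qed.

Lemma dittert_scale (R : realType) n (x : R) (A : 'M[R]_n) :
  dittert (x *: A) = x ^+ n * dittert A.
Proof.
have pr (F : 'I_n -> R) : \prod_i (x * F i) = x ^+ n * \prod_i F i.
  by rewrite big_split /= prodr_const card_ord.
rewrite /dittert mulrBr mulrDr; congr (_ + _ - _).
- by rewrite -pr; apply: eq_bigr => i _; rewrite row_sum_scale.
- by rewrite -pr; apply: eq_bigr => i _; rewrite col_sum_scale.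
rewrite /permanent mulr_sumr; apply: eq_bigr => s _.
by rewrite -pr; apply: eq_bigr => i _; rewrite mxE.
Qed.

(** * The uniform matrix *)

Section Uniform.
Variables (R : realType) (n : nat).
Hypothesis n_gt0 : (0 < n)%N.
Let J : 'M[R]_n := n%:R^-1 *: allones R n.
Let nn : n%:R != 0 :> R. Proof. by rewrite pnatr_eq0 -lt0n. Qed.

Lemma row_sum_uniform i : row_sum J i = 1.
Proof.
rewrite row_sum_scale /row_sum (eq_bigr (fun=> 1)); last by move=> j _; rewrite mxE.
by rewrite sumr_const card_ord mulVf.
Qed.

Lemma Kset_uniform : Kset J.
Proof.
split; first by move=> i j; rewrite !mxE mulr1 invr_ge0.
by rewrite (eq_bigr (fun=> 1)) ?sumr_const ?card_ord // => i _; apply: row_sum_uniform.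
Qed.

Lemma dittert_uniform : dittert J = 2 - vdw R n.
Proof.
have trJ : J^T = J by apply/matrixP => i j; rewrite !mxE.
have permJ : permanent J = vdw R n.
  rewrite /permanent (eq_bigr (fun=> n%:R^-1 ^+ n)).
    by rewrite sumr_const card_Sn /vdw exprVn mulr_natl.
  move=> s _; rewrite (eq_bigr (fun=> n%:R^-1)) ?prodr_const ?card_ord //.
  by move=> i _; rewrite !mxE mulr1.
rewrite /dittert permJ !big1 // => i _; rewrite ?row_sum_uniform //.
by rewrite -row_sum_tr trJ row_sum_uniform.
Qed.

End Uniform.

(** * Kuhn-Tucker conditions at a maximizer *)

Section KKT.
Variables (R : realType) (n : nat) (A : 'M[R]_n).
Hypothesis n_ge17 : (17 <= n)%N.
Hypothesis KA : Kset A.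
Hypothesis Amax : forall B : 'M[R]_n, Kset B -> dittert B <= dittert A.

Local Notation eps := (vdw R n).
Local Notation r := (row_sum A).
Local Notation c := (col_sum A).
Local Notation RP := (\prod_i r i).
Local Notation CP := (\prod_j c j).
Local Notation P := (permanent A).
Let A0 : forall i j, 0 <= A i j := KA.1.
Let n_gt0 : (0 < n)%N. Proof. by lia. Qed.
Let nR : 0 < n%:R :> R. Proof. by rewrite ltr0n. Qed.

Let eps_small : 25 * n%:R ^+ 4 * eps <= 1. Proof. exact: vdw_small. Qed.

Let eps_lt1 : eps < 1.
Proof.
have e0 := vdw_gt0 R n; have n1 : 1 <= n%:R ^+ 4 :> R by rewrite exprn_ege1 // ler1n.
have := ler_wpM2r (ltW e0) n1; have := eps_small; lra.
Qed.

Lemma row_sum_ge0 i : 0 <= r i. Proof. exact: sumr_ge0. Qed.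
Lemma col_sum_ge0 i : 0 <= c i. Proof. exact: sumr_ge0. Qed.

Lemma sum_rows : \sum_i r i = n%:R. Proof. exact: KA.2. Qed.
Lemma sum_cols : \sum_i c i = n%:R. Proof. by rewrite exchange_big /= KA.2. Qed.

Let RP_le1 : RP <= 1. Proof. exact: prod_mean1_le row_sum_ge0 sum_rows. Qed.
Let CP_le1 : CP <= 1. Proof. exact: prod_mean1_le col_sum_ge0 sum_cols. Qed.

Lemma permanent_le : P <= eps + RP + CP - 2.
Proof.
have := Amax (Kset_uniform R n_gt0); rewrite (dittert_uniform R n_gt0) /dittert; lra.
Qed.

Let P0 : 0 <= P. Proof. exact: permanent_ge0. Qed.

Lemma prod_row_sum_ge : 1 - eps <= RP.
Proof. by have := permanent_le; have := P0; have := CP_le1; lra. Qed.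

Lemma prod_col_sum_ge : 1 - eps <= CP.
Proof. by have := permanent_le; have := P0; have := RP_le1; lra. Qed.

Let RP0 : 0 < RP. Proof. by have := prod_row_sum_ge; have := eps_lt1; lra. Qed.
Let CP0 : 0 < CP. Proof. by have := prod_col_sum_ge; have := eps_lt1; lra. Qed.

Lemma row_sum_gt0 i : 0 < r i.
Proof.
rewrite lt_neqAle row_sum_ge0 andbT; apply: contraTneq RP0 => e.
by rewrite (bigD1 i) //= -e mul0r ltxx.
Qed.

Lemma col_sum_gt0 j : 0 < c j.
Proof.
rewrite lt_neqAle col_sum_ge0 andbT; apply: contraTneq CP0 => e.
by rewrite (bigD1 j) //= -e mul0r ltxx.
Qed.

(** The partial derivative of [dittert] in the entry [(i, j)]; since [dittert] is affine in each
    entry, it is an exact slope. *)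
Let grad i j := RP / r i + CP / c j - pminor A i j.

Let dittert_delta i j x :
  dittert (A + x *: delta_mx i j) = dittert A + x * grad i j.
Proof.
rewrite /dittert prod_row_delta prod_col_delta permanent_delta /grad.
rewrite [\prod_k r k](bigD1 i) //= [\prod_k c k](bigD1 j) //=.
have := row_sum_gt0 i; have := col_sum_gt0 j => c0 r0.
by field; rewrite !gt_eqF.
Qed.

(* By homogeneity, adding [e] to one entry multiplies the maximum by at most
   [(1 + e / n) ^+ n <= (1 - e)^-1]. *)
Let grad_le i j : grad i j <= dittert A.
Proof.
set phi := dittert A; set d := grad i j.
suff H (e : R) : 0 < e -> e <= 1 / 2 -> d <= phi + e * d.
  apply: (@le_linear_perturb _ _ _ (`|d| / 2)) => e e0 e1.
  have e2 : 0 < e / 2 by rewrite divr_gt0.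
  apply: le_trans (H _ e2 _) _; first by lra.
  by have := ler_wpM2l (ltW e0) (ler_norm d); lra.
(* Adding [e] to an entry makes the total [n%:R * (1 + x)], so dividing by [1 + x] returns to
   [Kset]. *)
move=> e0 e1; pose x := e / n%:R; have x0 : 0 < x by rewrite divr_gt0.
have xn : n%:R * x = e by rewrite /x; field; rewrite gt_eqF.
have x1 : 0 < 1 + x by rewrite addr_gt0.
have KB : Kset ((1 + x)^-1 *: (A + e *: delta_mx i j)).
  split=> [k l|].
    rewrite !mxE mulr_ge0 ?invr_ge0 ?(ltW x1) // addr_ge0 // mulr_ge0 ?(ltW e0) ?ler0n //.
  rewrite (eq_bigr (fun k => (1 + x)^-1 * (r k + e * (k == i)%:R))); last first.
    move=> k _; rewrite -[LHS]/(row_sum _ k) row_sum_scale; congr (_ * _).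
    rewrite /row_sum (eq_bigr (fun l => A k l + e * (k == i)%:R * (l == j)%:R)).
      rewrite big_split /=; congr (_ + _).
      by rewrite (bigD1 j) //= eqxx big1 ?addr0 ?mulr1 // => l /negPf -> //; rewrite mulr0.
    by move=> l _; rewrite !mxE -mulrA -natrM mulnb.
  rewrite -mulr_sumr big_split /= sum_rows -mulr_sumr.
  rewrite [\sum_k (k == i)%:R](bigD1 i) //= eqxx big1 ?addr0 ?mulr1; last first.
    by move=> l /negPf ->.
  by rewrite -xn -{1}[n%:R]mulr1 -mulrDr mulrC mulfK // gt_eqF.
have := Amax KB; rewrite dittert_scale dittert_delta -/phi -/d => le1.
have phi0 : 0 <= phi.
  have := Amax (Kset_uniform R n_gt0); rewrite (dittert_uniform R n_gt0) -/phi.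
  by have := eps_lt1; lra.
have key : phi + e * d <= phi * (1 + x) ^+ n.
  move: le1; rewrite exprVn mulrC ler_pdivrMr ?exprn_gt0 //.
have x1' : x <= 1.
  have n1 : 1 <= n%:R :> R by rewrite ler1n.
  by rewrite ler_pdivrMr // mul1r; lra.
have bern := bernoulli_ge n (ltW x0) x1'; rewrite xn in bern.
have pw : (1 + x) ^+ n * (1 - e) <= 1.
  apply: le_trans (_ : (1 + x) ^+ n * (1 - x) ^+ n <= _).
    by rewrite ler_wpM2l ?exprn_ge0 // ltW.
  rewrite -exprMn exprn_ile1 //; first by rewrite mulr_ge0 ?subr_ge0 // ltW.
  by have := sqr_ge0 x; lra.
have e1' : 0 <= 1 - e by lra.
have := ler_wpM2r e1' key; rewrite -mulrA => /le_trans /(_ (ler_wpM2l phi0 pw)).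
rewrite mulr1 => h.
have : e * (d - phi - e * d) <= 0 by lra.
by rewrite pmulr_rle0 //; lra.
Qed.

Lemma pminor_ge i j : RP / r i + CP / c j - dittert A <= pminor A i j.
Proof. by have := grad_le i j; rewrite /grad; lra. Qed.

(** Complementary slackness: the terms [A i j * (dittert A - grad i j)] are nonnegative by
    [grad_le], and Laplace expansion along the rows shows that they sum to zero. *)
Lemma pminor_support i j :
  A i j * pminor A i j = A i j * (RP / r i + CP / c j - dittert A).
Proof.
pose F i j := A i j * (dittert A - grad i j).
have F0 k l : 0 <= F k l by rewrite mulr_ge0 // subr_ge0.
have rowF k : \sum_l F k l = r k * dittert A - RP - r k * 0 + P - \sum_l A k l * (CP / c l).
  rewrite (permanent_row A k) /F /grad.
  rewrite (eq_bigr (fun l => A k l * (dittert A - RP / r k) + A k l * pminor A k l -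
     A k l * (CP / c l))); last by move=> l _; ring.
  rewrite sumrB big_split /= -mulr_suml -/(r k).
  have := row_sum_gt0 k => rk; congr (_ - _); rewrite mulr0 subr0; congr (_ + _).
  by field; rewrite gt_eqF.
have colF : \sum_k \sum_l A k l * (CP / c l) = n%:R * CP.
  rewrite exchange_big /= (eq_bigr (fun=> CP)).
    by rewrite sumr_const card_ord mulr_natl.
  move=> l _; rewrite -mulr_suml -/(c l) mulrC divfK //.
  by rewrite gt_eqF // col_sum_gt0.
have : \sum_k \sum_l F k l = 0.
  rewrite (eq_bigr _ (fun k _ => rowF k)) sumrB colF.
  rewrite big_split sumrB sumrB /= -!mulr_suml sum_rows !sumr_const card_ord /dittert.
  by rewrite -[RP *+ n]mulr_natl -[P *+ n]mulr_natl; ring.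
move=> /eqP; rewrite psumr_eq0; last by move=> k _; apply: sumr_ge0.
move=> /allP/(_ i); rewrite mem_index_enum => /(_ isT) /=.
rewrite psumr_eq0 // => /allP/(_ j); rewrite mem_index_enum => /(_ isT) /= /eqP.
by rewrite /F /grad; lra.
Qed.

End KKT.

(** * A maximizer is doubly stochastic *)

Lemma sum_setT_split (R : nmodType) (I : finType) (S : {set I}) (F : I -> R) :
  \sum_i F i = \sum_(i in S) F i + \sum_(i in ~: S) F i.
Proof.
rewrite (bigID (mem S)) /=; congr (_ + _).
by apply: eq_bigl => i; rewrite inE.
Qed.

(** * Lower bounds on the permanent from diagonal blocks *)

Section Block.
Variables (R : realType) (n : nat) (A : 'M[R]_n).
Hypothesis A0 : forall i j, 0 <= A i j.
Implicit Types S T : {set 'I_n}.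

(** The mass on [S'] by [T'] is the row mass of [S'] minus what leaves [T'], at least
    [#|S'| + #|T'| - #|T|] up to the error [cut + 2 * dev]. This is the corner condition of
    [capacity_ge], and [gurvits] converts the capacity. *)
Lemma block_permanent_ge (dev cut : R) S T : #|S| = #|T| ->
    (forall S' : {set 'I_n}, `|\sum_(i in S') (row_sum A i - 1)| <= dev) ->
    (forall T' : {set 'I_n}, `|\sum_(j in T') (col_sum A j - 1)| <= dev) ->
    \sum_(i in S) \sum_(j in ~: T) A i j <= cut ->
    0 <= dev -> 0 <= cut -> cut + 2 * dev < 1 ->
  (1 - (cut + 2 * dev)) ^+ #|S| * vdw R #|S| <= mper [seq A i | i <- enum S] T.
Proof.
move=> cST devr devc cutST dev0 cut0 small; set tau := 1 - _.
have tau0 : 0 < tau by rewrite subr_gt0.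
have sz : size (enum S) = #|S| by rewrite cardE.
rewrite /vdw mulrA -sz; apply: gurvits => //.
- exact: enum_uniq.
- by rewrite sz.
move=> x x0; rewrite big_enum /=.
rewrite [X in _ <= X](eq_bigr (fun j => \sum_(i in S) x i * A i j)); last first.
  by move=> j _; rewrite big_enum.
rewrite sz cST; apply: capacity_ge => // S' T' sS sT.
have sumA_ge0 (U V : {set 'I_n}) : 0 <= \sum_(i in U) \sum_(j in V) A i j.
  by do 2 (apply: sumr_ge0 => ? _).
have [le0|gt0] := leqP (#|S'| + #|T'|) #|T|.
  by rewrite (eqP le0) mulr0.
have rowdec : \sum_(i in S') \sum_(j in T') A i j +
    \sum_(i in S') \sum_(j in ~: T') A i j = \sum_(i in S') row_sum A i.
  by rewrite -big_split; apply: eq_bigr => i _; rewrite /row_sum (sum_setT_split T').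
have compl : \sum_(i in S') \sum_(j in ~: T') A i j <=
    \sum_(i in S) \sum_(j in ~: T) A i j + \sum_(j in T :\: T') col_sum A j.
  have -> : \sum_(i in S') \sum_(j in ~: T') A i j =
      \sum_(i in S') \sum_(j in ~: T) A i j + \sum_(i in S') \sum_(j in T :\: T') A i j.
    rewrite -big_split; apply: eq_bigr => i _ /=.
    rewrite (bigID (mem T)) /= addrC; congr (_ + _); apply: eq_bigl => j.
      by rewrite !inE; case: (boolP (j \in T)) => jT; rewrite ?andbF // andbT (contra (subsetP sT j)).
    by rewrite !inE.
  apply: lerD.
    rewrite [leRHS](big_setID S') /= (setIidPr sS) lerDl; exact: sumA_ge0.
  rewrite exchange_big; apply: ler_sum => j _ /=.
  rewrite /col_sum [leRHS](sum_setT_split S') lerDl; exact: sumr_ge0.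
have dr := devr S'; rewrite sumrB sumr_const ler_norml in dr.
have dc := devc (T :\: T'); rewrite sumrB sumr_const ler_norml in dc.
have cT : (#|T :\: T'| = #|T| - #|T'|)%N by rewrite cardsD (setIidPr sT).
have leT : (#|T'| <= #|T|)%N by apply: subset_leq_card.
move/andP: dr => [dr _]; move/andP: dc => [_ dc].
rewrite cT natrB // in dc.
rewrite natrB ?(ltnW gt0) // natrD.
(* The excess is a positive integer, so the additive error is absorbed into the factor [tau]. *)
have one : 1 <= #|S'|%:R + #|T'|%:R - #|T|%:R :> R.
  by rewrite lerBrDr nat1r -natrD ler_nat.
have : (cut + 2 * dev) * 1 <= (cut + 2 * dev) * (#|S'|%:R + #|T'|%:R - #|T|%:R).
  by rewrite ler_wpM2l // addr_ge0 // mulr_ge0.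
rewrite /tau; lra.
Qed.

Lemma permanent_block_split S T :
  mper [seq A i | i <- enum S] T * mper [seq A i | i <- enum (~: S)] (~: T) <= permanent A.
Proof.
have pe : perm_eq (enum S ++ enum (~: S)) (enum 'I_n).
  apply: uniq_perm; rewrite ?enum_uniq ?cat_uniq ?enum_uniq ?andbT //=.
    by apply/hasPn => i; rewrite !mem_enum inE.
  by move=> i; rewrite mem_cat !mem_enum !inE orbN.
rewrite (permanentE A pe) map_cat -(setUCr T); apply: mper_cat_ge.
- exact: nng_map.
- exact: nng_map.
by rewrite -setI_eq0 setICr.
Qed.

End Block.

(** * Energy estimate and exclusion of a two-block maximizer *)

Section Spectral.
Variables (R : realType) (n : nat) (A : 'M[R]_n).
Hypothesis n_ge17 : (17 <= n)%N.
Hypothesis KA : Kset A.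
Hypothesis Amax : forall B : 'M[R]_n, Kset B -> dittert B <= dittert A.

Local Notation eps := (vdw R n).
Local Notation r := (row_sum A).
Local Notation c := (col_sum A).
Local Notation RP := (\prod_i r i).
Local Notation CP := (\prod_j c j).
Local Notation P := (permanent A).
Let A0 : forall i j, 0 <= A i j := KA.1.
Let n_gt0 : (0 < n)%N. Proof. by lia. Qed.
Let nR : 0 < n%:R :> R. Proof. by rewrite ltr0n. Qed.
Let r0 i : 0 < r i. Proof. exact: row_sum_gt0. Qed.
Let c0 i : 0 < c i. Proof. exact: col_sum_gt0. Qed.
Let RP0 : 0 < RP. Proof. by apply: prodr_gt0. Qed.
Let CP0 : 0 < CP. Proof. by apply: prodr_gt0. Qed.
Let RP_le1 : RP <= 1.
Proof. exact: prod_mean1_le (fun i => ltW (r0 i)) (sum_rows KA). Qed.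
Let CP_le1 : CP <= 1.
Proof. exact: prod_mean1_le (fun i => ltW (c0 i)) (sum_cols KA). Qed.

Let f i := 1 - (r i)^-1.
Let g j := 1 - (c j)^-1.

Let rf i : r i * f i = r i - 1.
Proof. by rewrite /f; have := r0 i => h; field; rewrite gt_eqF. Qed.

Let cg j : c j * g j = c j - 1.
Proof. by rewrite /g; have := c0 j => h; field; rewrite gt_eqF. Qed.

Let sum_rf : \sum_i r i * f i = 0.
Proof.
rewrite (eq_bigr _ (fun i _ => rf i)) sumrB (sum_rows KA) sumr_const card_ord.
by rewrite subrr.
Qed.

Let sum_cg : \sum_j c j * g j = 0.
Proof.
rewrite (eq_bigr _ (fun i _ => cg i)) sumrB (sum_cols KA) sumr_const card_ord.
by rewrite subrr.
Qed.

Let minor_eq i j :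
  A i j * pminor A i j = A i j * (P - RP * f i - CP * g j).
Proof.
rewrite (pminor_support n_ge17 KA Amax) /f /g /dittert; ring.
Qed.

(** Summing [minor_eq] down the column gives [P] by Laplace expansion, and [P * (c j - 1)] is
    rewritten by [cg]. *)
Let col_eq j : RP * \sum_i A i j * f i = (P - CP) * (c j * g j).
Proof.
have := permanent_col A j.
rewrite (eq_bigr (fun i => A i j * (P - CP * g j) - RP * (A i j * f i))); last first.
  by move=> i _; rewrite minor_eq; ring.
rewrite sumrB -mulr_suml -mulr_sumr -/(c j) => e.
by have := congr1 (fun x => P * x) (cg j); move=> /= cgP; lra.
Qed.

Let row_eq i : CP * \sum_j A i j * g j = (P - RP) * (r i * f i).
Proof.
have := permanent_row A i.
rewrite (eq_bigr (fun j => A i j * (P - RP * f i) - CP * (A i j * g j))); last first.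
  by move=> j _; rewrite minor_eq; ring.
rewrite sumrB -mulr_suml -mulr_sumr -/(r i) => e.
by have := congr1 (fun x => P * x) (rf i); move=> /= rfP; lra.
Qed.

Let X := \sum_i r i * f i ^+ 2.
Let Y := \sum_j c j * g j ^+ 2.
Let Z := \sum_i \sum_j A i j * f i * g j.
Let E := \sum_i \sum_j A i j * (f i + g j) ^+ 2.

Let EE : E = X + Y + 2 * Z.
Proof.
rewrite /E (eq_bigr (fun i => r i * f i ^+ 2 + \sum_j A i j * g j ^+ 2 +
   2 * \sum_j A i j * f i * g j)).
  rewrite !big_split /= -mulr_sumr -/X -/Z; congr (_ + _ + _).
  by rewrite exchange_big; apply: eq_bigr => j _; rewrite -mulr_suml.
move=> i _; rewrite mulr_sumr /row_sum mulr_suml -!big_split; apply: eq_bigr => j _ /=.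
ring.
Qed.

Let ZX : CP * Z = (P - RP) * X.
Proof.
rewrite /Z /X [LHS]mulr_sumr [RHS]mulr_sumr; apply: eq_bigr => i _.
rewrite [\sum_j _](eq_bigr (fun j => f i * (A i j * g j))); last by move=> j _; ring.
by rewrite -mulr_sumr mulrCA row_eq; ring.
Qed.

Let ZY : RP * Z = (P - CP) * Y.
Proof.
rewrite /Z exchange_big /Y [LHS]mulr_sumr [RHS]mulr_sumr; apply: eq_bigr => j _ /=.
rewrite [\sum_i _](eq_bigr (fun i => g j * (A i j * f i))); last by move=> i _; ring.
by rewrite -mulr_sumr mulrCA col_eq; ring.
Qed.

Let X0 : 0 <= X.
Proof. by apply: sumr_ge0 => i _; rewrite mulr_ge0 ?sqr_ge0 // ltW. Qed.

Let Y0 : 0 <= Y.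
Proof. by apply: sumr_ge0 => i _; rewrite mulr_ge0 ?sqr_ge0 // ltW. Qed.

(** By [ZX] and [ZY], [Z] nearly cancels each of [X] and [Y], up to the factor [eps]; one copy of
    [Z] is spent on each. *)
Lemma energy_le : E <= eps * (X + Y).
Proof.
have Ple := permanent_le n_ge17 Amax; have e0 := vdw_gt0 R n.
(* The bound on [P] makes [P - b + a - eps * a] at most [(eps - 2) * (1 - a)], which is
   nonpositive. *)
have half (W a b : R) : 0 <= W -> 0 < a -> a <= 1 -> P <= eps + a + b - 2 ->
    a * Z = (P - b) * W -> W + Z <= eps * W.
  move=> W0 a0 a1 Pab aZ; rewrite -(ler_pM2l a0) mulrDr aZ.
  have : (P - b + a - eps * a) * W <= 0 * W.
    rewrite ler_wpM2r //; have : eps * (1 - a) <= 1 * (1 - a).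
      rewrite ler_wpM2r ?subr_ge0 //; have := vdw_small R n_ge17.
      have n1 : 1 <= n%:R ^+ 4 :> R by rewrite exprn_ege1 // ler1n.
      by have := ler_wpM2r (ltW e0) n1; lra.
    lra.
  lra.
have h1 := half X CP RP X0 CP0 CP_le1 _ ZX.
have h2 := half Y RP CP Y0 RP0 RP_le1 _ ZY.
by rewrite EE; have := h1 ltac:(lra); have := h2 ltac:(lra); lra.
Qed.


Lemma max_stochastic : (forall i, r i = 1) /\ (forall j, c j = 1).
Proof.
(* With the sign of [g] reversed, [f i + g j] becomes a difference of values of [z], to which a gap
   applies. *)
pose z (v : 'I_n + 'I_n) : R := match v with inl i => f i | inr j => - g j end.
pose i0 := Ordinal n_gt0.
have [v0 _ zmin'] := @arg_minP _ R _ (inl i0) predT z isT.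
have [v1 _ zmax'] := @arg_maxP _ R _ (inl i0) predT z isT.
have zmin v : z v0 <= z v := zmin' v isT.
have zmax v : z v <= z v1 := zmax' v isT.
have [lt01|le10] := ltP (z v0) (z v1); last first.
  have zc v : z v = z v0.
    by apply/le_anti; rewrite zmin // andbT (le_trans _ le10) // zmax.
  have fc i : f i = z v0 := zc (inl i).
  have gc j : - g j = z v0 := zc (inr j).
  have z0 : z v0 = 0.
    have := sum_rf; rewrite (eq_bigr (fun i => r i * z v0)) => [|i _]; last by rewrite fc.
    rewrite -mulr_suml (sum_rows KA) => /eqP.
    by rewrite mulf_eq0 gt_eqF //= => /eqP.
  split=> [i|j]; apply/eqP; rewrite -subr_eq0.
    by rewrite -rf fc z0 mulr0.
  by rewrite -cg -[g j]opprK gc z0 oppr0 mulr0.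
exfalso.
have [U [v1U v0U gap]] := spectral_gap_set lt01.
have cardV : #|{: 'I_n + 'I_n}| = (n + n)%N by rewrite card_sum card_ord.
rewrite cardV in gap.
clear zmin' zmax'; set M := z v1 in zmax lt01 gap; set m := z v0 in zmin lt01 gap.
pose S := [set i | inl i \in U]; pose T := [set j | inr j \in U].
have inS i : (i \in S) = (inl i \in U) by rewrite inE.
have inT j : (j \in T) = (inr j \in U) by rewrite inE.
have e0 := vdw_gt0 R n; have esmall := vdw_small R n_ge17.
have N17 : 17 <= n%:R :> R by rewrite (ler_nat R 17).
(* Weighted by row or column sums, the linear term vanishes by [sum_rf] or [sum_cg], which bounds
   [X] and [Y] by the range of [z]. *)
have quad v : z v ^+ 2 <= (M + m) * z v - M * m.
  have := mulr_ge0 (_ : 0 <= M - z v) (_ : 0 <= z v - m).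
  by rewrite !subr_ge0 zmax zmin => /(_ isT isT); lra.
have Xle : X <= - (M * m) * n%:R.
  apply: le_trans (_ : \sum_i r i * ((M + m) * f i - M * m) <= _).
    by apply: ler_sum => i _; rewrite ler_wpM2l ?(ltW (r0 i)) // (quad (inl i)).
  rewrite (eq_bigr (fun i => (M + m) * (r i * f i) - r i * (M * m))); last by move=> i _; ring.
  by rewrite sumrB -mulr_sumr sum_rf -mulr_suml (sum_rows KA); lra.
have Yle : Y <= - (M * m) * n%:R.
  apply: le_trans (_ : \sum_j c j * ((M + m) * (- g j) - M * m) <= _).
    apply: ler_sum => j _; rewrite ler_wpM2l ?(ltW (c0 j)) // -sqrrN.
    exact: (quad (inr j)).
  rewrite (eq_bigr (fun j => - (M + m) * (c j * g j) - c j * (M * m))); last by move=> j _; ring.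
  by rewrite sumrB -mulr_sumr sum_cg -mulr_suml (sum_cols KA); lra.
set rho := M - m in gap.
have rho0 : 0 < rho by rewrite subr_gt0.
have XYle : X + Y <= n%:R / 2 * rho ^+ 2.
  have := mulr_ge0 (ltW nR) (sqr_ge0 (M + m)); rewrite /rho; lra.
(* The mass outside the blocks [S] by [T] and [~: S] by [~: T]; each such entry straddles the gap,
   whose width is at least [w]. *)
pose cutf := \sum_(i in S) \sum_(j in ~: T) A i j + \sum_(i in ~: S) \sum_(j in T) A i j.
pose w := rho / (n + n)%:R.
have w0 : 0 < w by rewrite divr_gt0 // ltr0n addn_gt0 n_gt0.
have sqw (x : R) : w <= x \/ w <= - x -> w ^+ 2 <= x ^+ 2.
  have sq (y : R) : w <= y -> w ^+ 2 <= y ^+ 2.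
    by move=> wy; rewrite lerXn2r ?nnegrE ?(ltW w0) // (le_trans (ltW w0)).
  by case=> /sq //; rewrite sqrrN.
have cutE : cutf * w ^+ 2 <= E.
  rewrite /E (sum_setT_split S) mulrDl !mulr_suml; apply: lerD; apply: ler_sum => i iS.
    rewrite (sum_setT_split T) mulr_suml -[leLHS]add0r; apply: lerD.
      by apply: sumr_ge0 => j _; rewrite mulr_ge0 ?sqr_ge0.
    apply: ler_sum => j jT; rewrite ler_wpM2l // sqw //; left.
    have := gap (inl i) (inr j); rewrite in_setC inT in jT; rewrite inS in iS.
    by move=> /(_ iS jT); rewrite /z opprK.
  rewrite (sum_setT_split T) mulr_suml -[leLHS]addr0; apply: lerD.
    apply: ler_sum => j jT; rewrite ler_wpM2l // sqw //; right.
    have := gap (inr j) (inl i); rewrite in_setC inS in iS; rewrite inT in jT.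
    by move=> /(_ jT iS); rewrite -/w /z /=; lra.
  by apply: sumr_ge0 => j _; rewrite mulr_ge0 ?sqr_ge0.
have cut_le : cutf <= 2 * n%:R ^+ 3 * eps.
  have w2 : 0 < w ^+ 2 by rewrite exprn_gt0.
  rewrite -(ler_pM2r w2); apply: le_trans cutE _; apply: le_trans energy_le _.
  apply: le_trans (ler_wpM2l (ltW e0) XYle) _.
  rewrite le_eqVlt; apply/orP; left; apply/eqP; rewrite /w natrD; field.
  by rewrite gt_eqF //; lra.
pose dev : R := (10 * n%:R)^-1.
(* Here 425 is 25 times 17, from [25 * n%:R ^+ 4 * eps <= 1] and [17 <= n]. *)
have n3 : 425 * n%:R ^+ 3 * eps <= 1.
  have p3 : 0 <= n%:R ^+ 3 * eps :> R by rewrite mulr_ge0 ?exprn_ge0 // ltW.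
  by have := ler_wpM2r p3 N17; lra.
have devr (S' : {set 'I_n}) : `|\sum_(i in S') (r i - 1)| <= dev.
  apply: (@sum_deviation_le _ _ _ eps) => //; last exact: ltW.
  - by move=> i; apply: ltW.
  - exact: sum_rows.
  exact: prod_row_sum_ge.
have devc (T' : {set 'I_n}) : `|\sum_(j in T') (c j - 1)| <= dev.
  apply: (@sum_deviation_le _ _ _ eps) => //; last exact: ltW.
  - by move=> i; apply: ltW.
  - exact: sum_cols.
  exact: prod_col_sum_ge.
have dev0 : 0 <= dev by rewrite invr_ge0 mulr_ge0 // ltW.
have devN : n%:R * dev = 10^-1 by rewrite /dev; field; rewrite gt_eqF.
set cut1 := \sum_(i in S) _ in cutf cutE cut_le.
set cut2 := \sum_(i in ~: S) _ in cutf cutE cut_le.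
have cut10 : 0 <= cut1 by do 2 (apply: sumr_ge0 => ? _).
have cut20 : 0 <= cut2 by do 2 (apply: sumr_ge0 => ? _).
pose eta := cutf + 2 * dev.
have eta0 : 0 <= eta by rewrite addr_ge0 ?mulr_ge0 ?addr_ge0.
(* The cut contributes at most 2/25 and the deviations 2/10. *)
have etaN : n%:R * eta <= 28 / 100.
  rewrite /eta mulrDr mulrCA devN.
  by have := ler_wpM2l (ltW nR) cut_le; lra.
have eta1 : eta < 1.
  have := ler_wpM2r eta0 N17; lra.
(* The row mass of [S] and the column mass of [T] differ by [cut1 - cut2], so the two integers are
   less than 1 apart. *)
have cST : #|S| = #|T|.
  have rS : \sum_(i in S) r i = \sum_(i in S) \sum_(j in T) A i j + cut1.
    by rewrite -big_split; apply: eq_bigr => i _; rewrite /row_sum (sum_setT_split T).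
  have cT : \sum_(j in T) c j = \sum_(i in S) \sum_(j in T) A i j + cut2.
    rewrite /cut2 [X in _ = X + _]exchange_big [X in _ = _ + X]exchange_big -big_split; apply: eq_bigr => j _ /=.
    by rewrite /col_sum (sum_setT_split S).
  have := devr S; have := devc T; rewrite !sumrB !sumr_const rS cT !ler_norml.
  move=> /andP[d1 d2] /andP[d3 d4]; rewrite /eta /cutf in eta1.
  have [lt|lt|//] := ltngtP #|S| #|T|.
    by suff : (1 : R) <= 0; [rewrite ler10 | move: lt; rewrite -(ler_nat R) -natr1; lra].
  by suff : (1 : R) <= 0; [rewrite ler10 | move: lt; rewrite -(ler_nat R) -natr1; lra].
have k0 : (0 < #|S|)%N.
  rewrite lt0n; apply/eqP => S0; have T0 : T = set0 by apply: cards0_eq; rewrite -cST.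
  have {}S0 := cards0_eq S0; case: (v1) v1U => [i|j] vU.
    by rewrite -inS S0 inE in vU.
  by rewrite -inT T0 inE in vU.
have cSC : (#|S| + #|~: S| = n)%N by rewrite cardsC card_ord.
have cTC : (#|T| + #|~: T| = n)%N by rewrite cardsC card_ord.
have cSTC : #|~: S| = #|~: T| by apply: (@addnI #|S|); rewrite cSC cST cTC.
have k1 : (0 < #|~: S|)%N.
  rewrite lt0n; apply/eqP => S0; have T0 : ~: T = set0 by apply: cards0_eq; rewrite -cSTC.
  have {}S0 := cards0_eq S0; case: (v0) v0U => [i|j] vU.
    by rewrite -inS -in_setC S0 inE in vU.
  by rewrite -inT -in_setC T0 inE in vU.
have cut2E : \sum_(i in ~: S) \sum_(j in ~: ~: T) A i j = cut2 by rewrite setCK.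
have small1 : cut1 + 2 * dev < 1 by rewrite /eta /cutf in eta1; lra.
have small2 : cut2 + 2 * dev < 1 by rewrite /eta /cutf in eta1; lra.
have b1 := block_permanent_ge A0 cST devr devc (lexx _) dev0 cut10 small1.
have := block_permanent_ge A0 cSTC devr devc (lexx _) dev0.
rewrite cut2E => /(_ cut20 small2) b2.
have tau0 : 0 <= 1 - eta by rewrite subr_ge0 ltW.
have pw k (x : R) : 0 <= x -> x <= eta -> (1 - eta) ^+ k * vdw R k <= (1 - x) ^+ k * vdw R k.
  move=> x0 xe; rewrite ler_wpM2r ?(ltW (vdw_gt0 _ _)) // lerXn2r ?nnegrE ?lerD2l ?lerN2 //.
  by rewrite subr_ge0 (le_trans xe) // ltW.
have {}b1 := le_trans (pw #|S| _ _ _) b1; have {}b2 := le_trans (pw #|~: S| _ _ _) b2.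
have vd := vdw_split R k0 k1; rewrite cSC in vd.
have prodle : (1 - eta) ^+ n * (vdw R #|S| * vdw R #|~: S|) <= P.
  apply: le_trans (permanent_block_split A0 S T).
  have -> : (1 - eta) ^+ n = (1 - eta) ^+ #|S| * (1 - eta) ^+ #|~: S|.
    by rewrite -exprD cSC.
  rewrite mulrACA; apply: ler_pM.
  - by rewrite mulr_ge0 ?exprn_ge0 // ltW ?vdw_gt0.
  - by rewrite mulr_ge0 ?exprn_ge0 // ltW ?vdw_gt0.
  - by apply: b1; [rewrite addr_ge0 ?mulr_ge0 | rewrite lerD2r lerDl].
  - by apply: b2; [rewrite addr_ge0 ?mulr_ge0 | rewrite lerD2r lerDr].
have bern := bernoulli_ge n eta0 (ltW eta1).
(* Bernoulli with [etaN]; together with the factor 2 of [vdw_split] this gives [P >= 1.44 * eps],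
   whereas [permanent_le] gives [P <= eps]. *)
have big : 72 / 100 <= (1 - eta) ^+ n by lra.
have Ple := permanent_le n_ge17 Amax.
have h : 72 / 100 * (2 * eps) <= P.
  apply: le_trans prodle; apply: ler_pM => //; first by rewrite divr_ge0.
  by rewrite mulr_ge0 // ltW.
suff : eps < eps by rewrite ltxx.
have := RP_le1; have := CP_le1; lra.
Qed.

End Spectral.

(** * A maximizer is uniform *)

Section Averaging.
Variables (R : realType) (n : nat).
Hypothesis n_ge17 : (17 <= n)%N.
Implicit Types (A B : 'M[R]_n) (i j k l : 'I_n) (L : {set 'I_n}).

Local Notation eps := (vdw R n).
Let n_gt0 : (0 < n)%N. Proof. by lia. Qed.

Definition maximizer A := Kset A /\ forall B, Kset B -> dittert B <= dittert A.

Lemma max_row_sum A i : maximizer A -> row_sum A i = 1.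
Proof. by move=> [KA Amax]; have [h _] := max_stochastic n_ge17 KA Amax. Qed.

Lemma max_col_sum A j : maximizer A -> col_sum A j = 1.
Proof. by move=> [KA Amax]; have [_ h] := max_stochastic n_ge17 KA Amax. Qed.

(** The upper bound is the comparison with the uniform matrix; the lower one is van der Waerden's,
    the case of one full block without error. *)
Lemma max_permanent A : maximizer A -> permanent A = eps.
Proof.
move=> mA; have [KA Amax] := mA; apply/le_anti/andP; split.
  have := permanent_le n_ge17 Amax.
  by rewrite !big1 => [|i _|j _]; rewrite ?max_row_sum ?max_col_sum //; lra.
have dr (S : {set 'I_n}) : `|\sum_(i in S) (row_sum A i - 1)| <= 0.
  by rewrite big1 ?normr0 // => i _; rewrite max_row_sum ?subrr.
have dc (S : {set 'I_n}) : `|\sum_(i in S) (col_sum A i - 1)| <= 0.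
  by rewrite big1 ?normr0 // => i _; rewrite max_col_sum ?subrr.
have := block_permanent_ge KA.1 (erefl #|[set: 'I_n]|) dr dc (_ : _ <= 0) (lexx 0) (lexx 0).
rewrite mulr0 addr0 subr0 expr1n mul1r cardsT card_ord (@permanentE _ _ A (enum [set: 'I_n])).
  by apply; rewrite ?ltr01 // big1 // => i _; rewrite setCT big_set0.
by rewrite enum_setT -enumT.
Qed.

Lemma max_pminor_ge A i j : maximizer A -> eps <= pminor A i j.
Proof.
move=> mA; have [KA Amax] := mA; apply: le_trans (pminor_ge n_ge17 KA Amax i j).
rewrite max_row_sum // max_col_sum // /dittert max_permanent //.
rewrite !big1 => [|l _|l _]; rewrite ?max_row_sum ?max_col_sum //; lra.
Qed.

(** Each permanent with a doubled row is at least [eps], because the minors are and row sums are 1;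
    Alexandrov's inequality bounds the product of the two by [eps ^+ 2], so both equal [eps]. *)
Lemma max_replace_row A i k t : maximizer A -> perm_eq [:: i, k & t] (enum 'I_n) ->
  mper [:: A i, A i & [seq A l | l <- t]] [set: 'I_n] = eps.
Proof.
move=> mA pt; have [KA Amax] := mA.
have A0 := KA.1; have e0 := vdw_gt0 R n.
set Q := fun a b => mper [:: a, b & [seq A l | l <- t]] [set: 'I_n].
have Qge a b u : perm_eq [:: a, b & u] (enum 'I_n) ->
    eps <= mper [:: A a, A a & [seq A l | l <- u]] [set: 'I_n].
  move=> pu; rewrite mper_cons.
  apply: le_trans (_ : \sum_(j in [set: 'I_n]) A a j * eps <= _).
    rewrite -mulr_suml (eq_bigl predT) => [|j]; last by rewrite inE.
    by rewrite -/(row_sum A a) max_row_sum // mul1r.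
  apply: ler_sum => j _; rewrite ler_wpM2l // (le_trans (max_pminor_ge b j mA)) //.
  rewrite /pminor -[map _ _]cats0 (@mper_perm _ _ _ _ _ (a :: u)) ?cats0 //.
  rewrite -(perm_cons b) (perm_trans (perm_rem_enum b)) // perm_sym.
  by rewrite (perm_trans _ pu) // (perm_catCA [:: b] [:: a]).
have Qi := Qge _ _ _ pt.
have pt' : perm_eq [:: k, i & t] (enum 'I_n).
  by rewrite (perm_trans _ pt) // (perm_catCA [:: k] [:: i]).
have Qk := Qge _ _ _ pt'.
have Qik : Q (A i) (A k) = eps by rewrite -(max_permanent mA) (permanentE A pt).
have cT : #|[set: 'I_n]| = (size [seq A l | l <- t]).+2.
  by rewrite cardsT cardT -(perm_size pt) /= size_map.
have := @alexandrov _ _ [set: 'I_n] [seq A l | l <- t] (A i) (A k) _ cT.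
rewrite -[mper [:: A i, A k & _] _]/(Q _ _) Qik => h.
have {}h := h (nng_map (f := A) (u := [:: i, k & t]) A0).
apply/le_anti; rewrite Qi andbT.
rewrite -(ler_pM2r e0) -expr2; apply: le_trans h.
by rewrite ler_wpM2l // (le_trans _ Qi) // ltW.
Qed.

Definition mix_rows (x : R) i k A : 'M[R]_n :=
  \matrix_(l, j) if l == i then (1 - x) * A i j + x * A k j
    else if l == k then x * A i j + (1 - x) * A k j else A l j.

(** By multilinearity the new permanent is a combination of four permanents equal to [eps], with
    weights summing to 1, while row and column sums stay 1. *)
Lemma max_mix_rows x i k A : i != k -> 0 <= x -> x <= 1 ->
  maximizer A -> maximizer (mix_rows x i k A).
Proof.
move=> ik x0 x1 mA; have [KA Amax] := mA; have A0 := KA.1.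
set B := mix_rows x i k A.
have y0 : 0 <= 1 - x by rewrite subr_ge0.
have rsB l : row_sum B l = 1.
  rewrite /row_sum; case: (eqVneq l i) => [->|li].
    under eq_bigr do rewrite mxE eqxx.
    by rewrite big_split /= -!mulr_sumr -!/(row_sum A _) !max_row_sum //; ring.
  case: (eqVneq l k) => [->|lk].
    under eq_bigr do rewrite mxE eq_sym (negPf ik) eqxx.
    by rewrite big_split /= -!mulr_sumr -!/(row_sum A _) !max_row_sum //; ring.
  under eq_bigr do rewrite mxE (negPf li) (negPf lk).
  exact: max_row_sum.
have csB j : col_sum B j = 1.
  have ki : k != i by rewrite eq_sym.
  rewrite -[RHS](max_col_sum j mA) /col_sum (bigD1 i) //= (bigD1 k) //=.
  rewrite [RHS](bigD1 i) //= [\sum_(l < n | l != i) A l j](bigD1 k) //= !addrA.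
  congr (_ + _); first by rewrite !mxE eqxx (negPf ki) eqxx; ring.
  by apply: eq_bigr => l /andP[li lk]; rewrite mxE (negPf li) (negPf lk).
have KB : Kset B.
  split.
    by move=> l j; rewrite mxE; case: ifP => _; [|case: ifP => _ //]; apply: addr_ge0; apply: mulr_ge0.
  by rewrite (eq_bigr _ (fun l _ => rsB l)) sumr_const card_ord.
have [t pt] : exists t, perm_eq [:: i, k & t] (enum 'I_n).
  exists (rem k (rem i (enum 'I_n))); rewrite perm_sym.
  rewrite (perm_trans (perm_to_rem (mem_enum _ i))) // perm_cons perm_to_rem //.
  by rewrite mem_rem_uniq ?enum_uniq // inE eq_sym ik mem_enum.
have pt' : perm_eq [:: k, i & t] (enum 'I_n).
  by rewrite (perm_trans _ pt) // (perm_catCA [:: k] [:: i]).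
have := perm_uniq pt; rewrite enum_uniq /= inE negb_or => /and3P[/andP[_ it] kt _].
have permB : permanent B = eps.
  rewrite (permanentE B pt) /=.
  have -> : [seq B l | l <- t] = [seq A l | l <- t].
    apply/eq_in_map => l lt; apply/funext => j; rewrite mxE.
    by case: eqP => [e|_]; [rewrite -e lt in it | case: eqP => // e; rewrite -e lt in kt].
  have -> : B i = (fun j => (1 - x) * A i j + x * A k j).
    by apply/funext => j; rewrite mxE eqxx.
  have -> : B k = (fun j => x * A i j + (1 - x) * A k j).
    by apply/funext => j; rewrite mxE eq_sym (negPf ik) eqxx.
  set s := [seq A l | l <- t].
  rewrite mperD !mperZ !(mper_swap (A _) (fun=> _)) !mperD !mperZ.
  have E1 : mper [:: A i, A i & s] [set: 'I_n] = eps := max_replace_row mA pt.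
  have E2 : mper [:: A k, A k & s] [set: 'I_n] = eps := max_replace_row mA pt'.
  have E3 : mper [:: A i, A k & s] [set: 'I_n] = eps.
    by rewrite -(max_permanent mA) (permanentE A pt).
  by rewrite E1 E2 (mper_swap (A k)) E3; ring.
split=> // C KC; apply: le_trans (Amax _ KC) _.
rewrite /dittert permB max_permanent // !big1 // => l _;
  by rewrite ?rsB ?csB ?max_row_sum ?max_col_sum.
Qed.

(** Rows are absorbed one at a time: an average of [m] rows mixed with a further row at weight
    [m.+1%:R^-1] is the average of all [m.+1]. The other rows of [L] are left uncontrolled. *)
Lemma max_average_row L i A : maximizer A -> i \in L ->
  exists B, [/\ maximizer B, forall l, l \notin L -> B l = A l &
    forall j, B i j = #|L|%:R^-1 * \sum_(l in L) A l j].
Proof.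
move=> mA; move: {2}#|L| (erefl #|L|) => m; elim: m L => [|m IH] L cL iL.
  by rewrite (cards0_eq cL) inE in iL.
have [L1|/set0Pn[l]] := eqVneq (L :\ i) set0.
  exists A; split=> // j; have -> : L = [set i] by rewrite -(setD1K iL) L1 setU0.
  by rewrite cards1 big_set1 invr1 mul1r.
rewrite !inE => /andP[li lL].
have cL' : #|L :\ l| = m by move: cL; rewrite (cardsD1 l) lL => -[].
have iL' : i \in L :\ l by rewrite !inE eq_sym li.
have [B [mB Boff Bi]] := IH _ cL' iL'.
have m0 : (0 < m)%N by rewrite -cL'; apply/card_gt0P; exists i.
have mR : m%:R != 0 :> R by rewrite pnatr_eq0 -lt0n.
have mR1 : m.+1%:R != 0 :> R by rewrite pnatr_eq0.
have x0 : 0 <= m.+1%:R^-1 :> R by rewrite invr_ge0.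
have x1 : m.+1%:R^-1 <= 1 :> R by rewrite invf_le1 ?ler1n ?ltr0n.
exists (mix_rows m.+1%:R^-1 i l B); split.
- by apply: max_mix_rows => //; rewrite eq_sym.
- move=> k kL; apply/funext => j; rewrite mxE.
  case: eqP => [e|_]; first by rewrite e iL in kL.
  case: eqP => [e|_]; first by rewrite e lL in kL.
  by rewrite Boff // !inE (negPf kL) andbF.
move=> j; rewrite mxE eqxx Bi Boff ?inE ?eqxx // cL' cL (big_setD1 l lL) /=.
set s := \sum_(_ in _) _; rewrite -natr1; field.
by rewrite natr1 mR mR1.
Qed.

(** Once row [i] is the average, the other rows of [L] have the same average, so the induction on
    [L :\ i] produces the same row. *)
Lemma max_average L A : maximizer A ->
  exists B, [/\ maximizer B, forall l, l \notin L -> B l = A l &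
    forall l j, l \in L -> B l j = #|L|%:R^-1 * \sum_(k in L) A k j].
Proof.
move: {2}#|L| (erefl #|L|) => m; elim: m L A => [|m IH] L A cL mA.
  by exists A; split=> // l j; rewrite (cards0_eq cL) inE.
have /card_gt0P[i iL] : (0 < #|L|)%N by rewrite cL.
have [B1 [mB1 B1off B1i]] := max_average_row mA iL.
have cL' : #|L :\ i| = m by move: cL; rewrite (cardsD1 i) iL => -[].
have [B [mB Boff Bon]] := IH (L :\ i) B1 cL' mB1.
(* All column sums are 1 and the rows outside [L] are unchanged, so the rows of [L] keep their
   total. *)
have sumL j : \sum_(k in L) B1 k j = \sum_(k in L) A k j.
  have := max_col_sum j mA; rewrite -(max_col_sum j mB1) /col_sum.
  rewrite (sum_setT_split L) [in RHS](sum_setT_split L) => /esym.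
  rewrite [\sum_(i in ~: L) B1 i j](eq_bigr (fun k => A k j)) => [/addIr //|k].
  by rewrite inE => /B1off ->.
exists B; split=> //.
  by move=> l lL; rewrite Boff ?B1off // inE (negPf lL) andbF.
move=> l j lL; have [->|li] := eqVneq l i; first by rewrite Boff ?B1i // !inE eqxx.
have lL' : l \in L :\ i by rewrite !inE li.
have m0 : (0 < m)%N by rewrite -cL'; apply/card_gt0P; exists l.
have mR : m%:R != 0 :> R by rewrite pnatr_eq0 -lt0n.
have mR1 : m.+1%:R != 0 :> R by rewrite pnatr_eq0.
have := sumL j; rewrite (big_setD1 i iL) /= B1i Bon // cL' cL => e.
rewrite (_ : \sum_(k in L :\ i) B1 k j = (1 - m.+1%:R^-1) * \sum_(k in L) A k j).
  by rewrite -natr1; field; rewrite mR natr1 mR1.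
by apply: (addrI (m.+1%:R^-1 * \sum_(k in L) A k j)); rewrite e; ring.
Qed.

Lemma maximizer_uniform A : maximizer A -> A = n%:R^-1 *: allones R n.
Proof.
move=> mA; apply/matrixP => i j; rewrite !mxE mulr1.
have nR : n%:R != 0 :> R by rewrite pnatr_eq0 -lt0n.
have [B [mB Boff Bon]] := max_average [set~ i] mA.
have [k ki] : exists k, k != i.
  have : (0 < #|[set~ i]|)%N by rewrite cardsC1 card_ord; lia.
  by move=> /card_gt0P[k]; rewrite !inE => ki; exists k.
pose b := B k.
have Bb l : l != i -> B l = b.
  by move=> li; apply/funext => m; rewrite /b !Bon ?inE.
have [t pt] : exists t, perm_eq [:: k, i & t] (enum 'I_n).
  exists (rem i (rem k (enum 'I_n))); rewrite perm_sym.
  rewrite (perm_trans (perm_to_rem (mem_enum _ k))) // perm_cons perm_to_rem //.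
  by rewrite mem_rem_uniq ?enum_uniq // inE eq_sym ki mem_enum.
have st : size t = n.-2.
  by have /(congr1 (fun m => m.-2)) := perm_size pt; rewrite size_enum_ord.
have := perm_uniq pt; rewrite enum_uniq /= inE => /and3P[_ it _].
have tb : [seq B l | l <- t] = nseq n.-2 b.
  have -> : [seq B l | l <- t] = [seq b | _ <- t].
    by apply/eq_in_map => l lt; apply: Bb; apply: contraTneq lt => ->.
  by rewrite -st; elim: (t) => //= _ u ->.
(* Row [i], the only one that may differ from [b], is replaced by a copy of [b]; the permanent of
   [n] equal rows is then explicit. *)
have := max_replace_row mB pt.
rewrite tb -/b -[[:: b, b & _]]/(nseq n.-2.+2 b).
have -> : n.-2.+2 = n by lia.
rewrite mper_nseq; last by rewrite cardsT card_ord.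
have fn0 : n`!%:R != 0 :> R by rewrite pnatr_eq0 -lt0n fact_gt0.
rewrite /vdw => /(mulfI fn0); rewrite (eq_bigl predT) => [prodb|l]; last by rewrite inE.
have r0 l : 0 <= n%:R * b l.
  by apply: mulr_ge0; rewrite ?ler0n //; have [[B0 _] _] := mB; apply: B0.
have rs : \sum_l n%:R * b l = n%:R.
  by rewrite -mulr_sumr -[\sum_l b l]/(row_sum B k) max_row_sum ?mulr1.
(* The equality case of AM-GM makes [b] constant; the column sums then determine row [i], on which
   [B] agrees with [A]. *)
have [_] := prod_mean1_le r0 rs.
rewrite big_split /= prodr_const card_ord prodb divff ?expf_neq0 // eqxx.
move=> /esym/forallP/(_ j)/eqP bj.
have {}bj : b j = n%:R^-1 by apply: (mulfI nR); rewrite bj divff.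
have := max_col_sum j mB; rewrite /col_sum (bigD1 i) //= Boff ?inE ?negbK //.
rewrite (eq_bigr (fun=> n%:R^-1)) => [|l li]; last by rewrite Bb.
rewrite sumr_const cardC1 card_ord => e; apply: (addIr (n%:R^-1 *+ n.-1)).
by rewrite e -mulrS prednK // -[RHS]mulr_natl divff.
Qed.

End Averaging.

Theorem theorem1 (R : realType) (n : nat) (n_ge17 : (17 <= n)%N) :
  [/\ forall A : 'M[R]_n, Kset A ->
        dittert A <= dittert (n%:R^-1 *: allones R n),
      dittert (n%:R^-1 *: allones R n) = 2 - (n`!)%:R / n%:R ^+ n
    & forall A : 'M[R]_n, Kset A ->
        (dittert A = dittert (n%:R^-1 *: allones R n)
         <-> A = n%:R^-1 *: allones R n)].
Proof.
have n_gt0 : (0 < n)%N by apply: leq_trans n_ge17.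
have [A [KA Amax]] := dittert_max_exists (Kset_uniform R n_gt0).
have AJ := maximizer_uniform n_ge17 (conj KA Amax).
rewrite AJ in Amax; split=> //; first exact: dittert_uniform.
(* A matrix attaining the maximal value is itself a maximizer, hence uniform. *)
move=> B KB; split=> [e|-> //].
by apply: (maximizer_uniform n_ge17); split=> // C KC; rewrite e Amax.
Qed.
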